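(* Let $\bar X=\mathrm{MC}(\alpha_X,P_X)$, $\bar Y=\mathrm{MC}(\alpha_Y,P_Y)$ and $\bar Z=\mathrm{MC}(\alpha_Z,P_Z)$ be homogeneous Markov chains on countable state spaces $A,B,C$, and let $f:A\to C$, $g:B\to C$ be maps with $(f(\bar X_t))_{t\ge0}\overset{d}{=}\bar Z\overset{d}{=}(g(\bar Y_t))_{t\ge0}$. Assume that each state in $A$ has positive probability of being visited by $\bar X$ and each state in $B$ has positive probability of being visited by $\bar Y$. Let $\Delta=\{(a,b)\in A\times B: f(a)=g(b)\}$ and let $R$ be the matrix with rows and columns indexed by $\Delta$ given by $$R\bigl((a,b),(a',b')\bigr)=\begin{cases}\dfrac{P_X(a,a')P_Y(b,b')}{P_Z(f(a),f(a'))}&\text{if }P_Z(f(a),f(a'))>0,\\ 0&\text{otherwise.}\end{cases}$$ Let $\mathbf 1_\Delta$ denote the column vector of $1$s indexed by $\Delta$. Then: (i) The coordinatewise limit $\varphi=\lim_{m\to\infty}R^m\mathbf 1_\Delta$ exists and is a non-negative right eigenvector of $R$ with eigenvalue $1$. (ii) Let $\Delta'=\{(a,b)\in\Delta:\varphi(a,b)>0\}$. For $(a,b)\in\Delta'$ with $c=f(a)=g(b)$ let $$\alpha(a,b)=\begin{cases}\dfrac{\alpha_X(a)\alpha_Y(b)}{\alpha_Z(c)}\,\varphi(a,b)&\text{if }\alpha_Z(c)>0,\\ 0&\text{if }\alpha_Z(c)=0,\end{cases}$$ and for $(a,b),(a',b')\in\Delta'$ let $$P((a,b),(a',b'))=\frac{1}{\varphi(a,b)}R\bigl((a,b),(a',b')\bigr)\varphi(a',b').$$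 Then $\alpha$ is a probability vector and $P$ is a stochastic matrix, indexed by $\Delta'$. (iii) The homogeneous Markov chain $(X_t,Y_t)_{t\ge0}=\mathrm{MC}(\alpha,P)$ satisfies $(X_t)_{t\ge0}\overset{d}{=}\bar X$, $(Y_t)_{t\ge0}\overset{d}{=}\bar Y$, $f(X_t)=g(Y_t)$ for all $t\ge0$, and the processes $X=(X_t)_{t\ge 0}$ and $Y=(Y_t)_{t\ge 0}$ are conditionally independent given the process $(f(X_t))_{t\ge0}$.
   Context: $\mathrm{MC}(\alpha,P)$ denotes the discrete-time homogeneous Markov chain with time indexed by $\{0,1,2,\dots\}$, initial distribution $\alpha$ and transition matrix $P$. $\overset{d}{=}$ denotes equality in law of processes. *)

(* Defs.v *)
From mathcomp Require Export all_boot all_order all_algebra.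
From mathcomp Require Export all_classical all_reals all_analysis.
Export Order.TTheory GRing.Theory Num.Theory.
Export numFieldNormedType.Exports.

Set Implicit Arguments.
Unset Strict Implicit.
Unset Printing Implicit Defensive.

Local Open Scope classical_set_scope.
Local Open Scope ring_scope.
Local Open Scope ereal_scope.

Section Vectors.
Context (R : realType) (I : countType).

Definition prob_vector (p : I -> R) : Prop :=
  (forall i, (0 <= p i)%R) /\ \esum_(i in [set: I]) (p i)%:E = 1.

Definition stochastic (M : I -> I -> R) : Prop := forall i, prob_vector (M i).

(* Products of countably infinite matrices. [esum] is a supremum of finite
   partial sums, so these are the matrix products only for non-negative entries;
   the values are extended reals because the series may a priori diverge. *)
Definition mx_mul (M N : I -> I -> \bar R) (i j : I) : \bar R :=
  \esum_(k in [set: I]) (M i k * N k j).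

Definition mx_one (i j : I) : \bar R := if i == j then 1 else 0.

Definition mx_pow (M : I -> I -> \bar R) (m : nat) : I -> I -> \bar R :=
  iter m (mx_mul M) mx_one.

Definition mx_app (M : I -> I -> \bar R) (v : I -> \bar R) (i : I) : \bar R :=
  \esum_(j in [set: I]) (M i j * v j).

Definition right_eigenvector (M : I -> I -> \bar R) (lambda : R) (v : I -> R)
    : Prop :=
  (exists i, v i != 0%R) /\
  (forall i, mx_app M (EFin \o v) i = (lambda * v i)%:E).

End Vectors.

(* The product sigma-algebra on the path space, each factor S being discrete.
   It is a bare set system because [measurableType] requires a pointed carrier. *)
Definition path_measurable (S : countType) : set_system (nat -> S) :=
  <<s [set E | exists (t : nat) (U : set S), E = [set x | U (x t)]] >>.

Section Processes.
Context (R : realType) (d : measure_display) (Omega : measurableType d).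

Definition is_process (S : countType) (X : nat -> Omega -> S) : Prop :=
  forall (t : nat) (U : set S), measurable (X t @^-1` U).

Definition trajectory (S : countType) (X : nat -> Omega -> S)
  (w : Omega) : nat -> S := fun t => X t w.

Definition law (Pr : probability Omega R) (S : countType)
    (X : nat -> Omega -> S) (E : set (nat -> S)) : \bar R :=
  Pr (trajectory X @^-1` E).

Definition cond_prob (Pr : probability Omega R) (A B : set Omega) : R :=
  (fine (Pr (A `&` B)) / fine (Pr B))%R.

(* X is a MC(alpha, P) on the probability space (Omega, Pr). *)
Definition is_MC (Pr : probability Omega R) (S : countType)
    (alpha : S -> R) (P : S -> S -> R) (X : nat -> Omega -> S) : Prop :=
  [/\ prob_vector alpha, stochastic P, is_process X,
      forall s, Pr [set w | X 0%N w = s] = (alpha s)%:E &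
      forall (t : nat) (x : nat -> S),
        let past := [set w | forall i, (i <= t)%N -> X i w = x i] in
        0 < Pr past ->
        cond_prob Pr [set w | X t.+1 w = x t.+1] past = P (x t) (x t.+1)].

(* The sigma-algebra on Omega generated by the whole process X. *)
Definition sigma_process (S : countType) (X : nat -> Omega -> S)
  : set_system Omega :=
  preimage_set_system [set: Omega] (trajectory X) (@path_measurable S).

(* u is a version of the conditional probability Pr(A | G). *)
Definition cond_prob_version (Pr : probability Omega R) (G : set_system Omega)
    (A : set Omega) (u : Omega -> R) : Prop :=
  [/\ forall B : set R, measurable B -> G (u @^-1` B),
      Pr.-integrable [set: Omega] (EFin \o u) &
      forall D, G D -> \int[Pr]_(w in D) (u w)%:E = Pr (A `&` D)].

(* Pr(X in E, Y in F | V) = Pr(X in E | V) Pr(Y in F | V) almost surely.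
   Versions are unique up to null sets, so it does not matter that u and v are
   quantified existentially. *)
Definition cond_independent (Pr : probability Omega R) (S1 S2 S3 : countType)
    (X : nat -> Omega -> S1) (Y : nat -> Omega -> S2) (V : nat -> Omega -> S3)
    : Prop :=
  forall E F, path_measurable E -> path_measurable F ->
  exists u v : Omega -> R,
    let XE := trajectory X @^-1` E in
    let YF := trajectory Y @^-1` F in
    [/\ cond_prob_version Pr (sigma_process V) XE u,
        cond_prob_version Pr (sigma_process V) YF v &
        cond_prob_version Pr (sigma_process V) (XE `&` YF)
          (fun w => (u w * v w)%R)].

End Processes.

Definition eq_law (R : realType) (S : countType)
    (d1 : measure_display) (Omega1 : measurableType d1)
    (Pr1 : probability Omega1 R) (X1 : nat -> Omega1 -> S)
    (d2 : measure_display) (Omega2 : measurableType d2)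
    (Pr2 : probability Omega2 R) (X2 : nat -> Omega2 -> S) : Prop :=
  forall E, path_measurable E -> law Pr1 X1 E = law Pr2 X2 E.

Section Coupling.
Context (R : realType) (A B C : countType) (f : A -> C) (g : B -> C).
Context (alphaX : A -> R) (alphaY : B -> R) (alphaZ : C -> R).
Context (PX : A -> A -> R) (PY : B -> B -> R) (PZ : C -> C -> R).

Definition Delta : countType := {ab : A * B | f ab.1 == g ab.2}.

Definition Rmx (x y : Delta) : R :=
  (let: (a, b) := val x in let: (a', b') := val y in
   if 0 < PZ (f a) (f a') then PX a a' * PY b b' / PZ (f a) (f a') else 0)%R.

Context (phi : Delta -> R).

Definition Delta' : countType := {x : Delta | (0 < phi x)%R}.

Definition fstD' (x : Delta') : A := (val (val x)).1.
Definition sndD' (x : Delta') : B := (val (val x)).2.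

Definition alphaD' (x : Delta') : R :=
  (let: (a, b) := val (val x) in
   if 0 < alphaZ (f a) then alphaX a * alphaY b / alphaZ (f a) * phi (val x)
   else 0)%R.

Definition PD' (x y : Delta') : R :=
  ((phi (val x))^-1 * Rmx (val x) (val y) * phi (val y))%R.

End Coupling.

(* Main.v *)
From HB Require Import structures.
Require Import Defs.
From mathcomp Require Import measurable_realfun lra ring.

Set Implicit Arguments.
Unset Strict Implicit.
Unset Printing Implicit Defensive.

Local Open Scope classical_set_scope.
Local Open Scope ring_scope.
Local Open Scope ereal_scope.

(** For a state a of X let H_a(s) be the probability that X, started from a, maps
    under f to the word s ([image_weight]), and let q_c(s) be the probability that
    Z, started from c, follows s ([path_weight]). Along Z started from c = f a the
    ratios H_a / q_c form a density martingale. It is bounded: a is reached with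
    positive probability along some path x, and going on from x is only one of the
    ways in which f(X), which has the law of Z, can follow the image of x and then
    s ([visited_dominated]).

    Expanding the power of R and summing over the paths of X and of Y above each
    path of Z, the entry of R^m 1 at (a, b) is the expectation under Z of the
    product of the m-step densities of a and b ([mx_pow_app_one]). Such
    expectations converge: by polarization it is enough to treat squares, which
    are bounded and increase by Cauchy-Schwarz ([pairing_cvg]). The limit phi is
    the overlap of the two conditional future laws. Summed over b, the terms of
    R (R^m 1) at a first step to a are bounded by a multiple of P_X(., a),
    uniformly in m; two applications of dominated convergence then give
    R phi = phi ([overlap_lim_step]). Treating the initial laws as the transitions
    of an additional starting state, written None, the same identity says that
    alpha has total mass phi(None, None) = 1.

    In the product of the transition weights of the coupled chain the values of phi
    telescope: with c the common image of x and y,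
    Pr (X = x, Y = y) = p_X(x) p_Y(y) / p_Z(c) * phi(end of x, end of y)
    ([joint_path_law]). Summing over all y above c leaves p_X(x), again by a
    computation at finite horizon and dominated convergence ([sum_overlap_lim]).

    For the conditional independence, write V for the common image process. The
    formula for the joint law and the definition of phi say that
    Pr (X = x, Y = y) is the limit of the expectation of
    Pr (X = x | V_0 .. V_k) Pr (Y = y | V_0 .. V_k). Elementary conditional
    probabilities converge weakly to the conditional probabilities given V
    ([elementary_version_cvg], [weak_test]), and in each expectation one of the two
    factors may be replaced by its limit beforehand; hence
    Pr (X = x, Y = y) is the expectation of Pr (X = x | V) Pr (Y = y | V).
    The pi-lambda theorem extends this to all events of X and of Y
    ([cond_factor_all]), and events of V are absorbed into those of X
    ([cond_independent_prefix]).

    The coupled chain exists because every countable chain can be read off a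
    uniform point of the unit interval by nested subdivisions
    ([realization_path_law]). *)

(** * Sums over countable types *)

Section Sums.
Context {R : realType}.

Lemma esumZl (T : choiceType) (D : set T) (r : R) (a : T -> \bar R) :
  (0 <= r)%R -> (forall i, D i -> 0 <= a i) ->
  \esum_(i in D) (r%:E * a i) = r%:E * \esum_(i in D) a i.
Proof.
move=> r0 a0; rewrite [in RHS]esum_mkcond esum_mkcond.
have a'0 i : 0 <= (if i \in D then a i else 0).
  by case: ifPn => // /[1!inE] /a0.
rewrite (eq_esum (b := fun i => r%:E * (if i \in D then a i else 0))); last first.
  by move=> i _; case: ifPn => //; rewrite mule0.
rewrite /esum -ereal_supZl//; last first.
  by apply/set0P; exists (\sum_(i \in set0) (if i \in D then a i else 0)) => /=;
     exists set0 => //; split.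
congr ereal_sup; apply/seteqP; split=> [_ [X fX <-]|_ [_ [X fX <-] <-]] /=.
  by exists (\sum_(i \in X) (if i \in D then a i else 0)); [exists X|rewrite ge0_mule_fsumr].
by exists X => //; rewrite ge0_mule_fsumr.
Qed.

Lemma esum_swap (T1 T2 : choiceType) (D1 : set T1) (D2 : set T2)
    (a : T1 -> T2 -> \bar R) :
  (forall i j, D1 i -> D2 j -> 0 <= a i j) ->
  \esum_(i in D1) \esum_(j in D2) a i j = \esum_(j in D2) \esum_(i in D1) a i j.
Proof.
move=> a0; rewrite esum_esum// esum_esum; last by move=> j i ? ?; exact: a0.
rewrite (reindex_esum (D2 `*`` fun=> D1) _ (fun x => (x.2, x.1)))//; split=> //=.
- by move=> [i j] [/=].
- by move=> [i1 i2] [j1 j2] /= _ _ [] -> ->.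
- by move=> [i1 i2] [Pi1 Qi2] /=; exists (i2, i1).
Qed.

Lemma esum_fibers (T C : choiceType) (D : set T) (f : T -> C) (a : T -> \bar R) :
  (forall x, D x -> 0 <= a x) ->
  \esum_(c in [set: C]) \esum_(x in [set x | D x /\ f x = c]) a x
    = \esum_(x in D) a x.
Proof.
move=> a0; rewrite esum_esum; last by move=> c x _ [/a0].
apply/esym/(reindex_esum _ _ snd (fun x => a x)); split=> /=.
- by move=> [c x] [_ []].
- move=> [c x] [c' x'] /[!inE]/= -[_ [_ <-]] [_ [_ <-]].
  by move=> ->.
- by move=> x Dx; exists (f x, x).
Qed.

Lemma esum_sig (T : countType) (P : pred T) (a : T -> \bar R) :
  \esum_(x in [set: {x | P x}]) a (val x) = \esum_(x in [set x | P x]) a x.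
Proof.
apply/esym/(reindex_esum _ _ val); split=> /=.
- by move=> x _; exact: valP.
- by move=> x y _ _; exact: val_inj.
- by move=> x Px; exists (Sub x Px).
Qed.

Lemma le_esum_term (T : choiceType) (D : set T) (a : T -> \bar R) x :
  (forall i, D i -> 0 <= a i) -> D x -> a x <= \esum_(i in D) a i.
Proof.
move=> a0 Dx; rewrite -[leLHS](@esum_set1 _ _ x a); last exact: a0.
rewrite esum_mkcond [leRHS]esum_mkcond; apply: le_esum => t _.
case: ifPn => [/[1!inE]/= ->|_]; first by rewrite ifT// inE.
by case: ifPn => // /[1!inE] /a0.
Qed.

Lemma esum_size0 (T : choiceType) (F : seq T -> \bar R) : 0 <= F [::] ->
  \esum_(s in [set s | size s = 0%N]) F s = F [::].
Proof.
by move=> F0; rewrite (_ : [set s | _] = [set [::]]) ?esum_set1//;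
  apply/seteqP; split=> [s /size0nil|s ->].
Qed.

Lemma esum_cons (T : choiceType) n (F : seq T -> \bar R) : (forall s, 0 <= F s) ->
  \esum_(s in [set s | size s = n.+1]) F s =
  \esum_(x in [set: T]) \esum_(s in [set s | size s = n]) F (x :: s).
Proof.
move=> F0; rewrite esum_esum//.
apply/(reindex_esum _ _ (fun xs => xs.1 :: xs.2)); split=> /=.
- by move=> [x s] [_ /= ->].
- by move=> [x s] [x' s'] /= _ _ [-> ->].
- by move=> [//|x s] /= [sn]; exists (x, s).
Qed.

Lemma esum_rcons (T : choiceType) n (F : seq T -> \bar R) : (forall s, 0 <= F s) ->
  \esum_(s in [set s | size s = n.+1]) F s =
  \esum_(s in [set s | size s = n]) \esum_(x in [set: T]) F (rcons s x).
Proof.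
move=> F0; rewrite esum_esum//.
apply/(reindex_esum _ _ (fun xs => rcons xs.1 xs.2)); split=> /=.
- by move=> [s x] [/= <- _]; rewrite size_rcons.
- by move=> [s x] [s' x'] /= _ _ /rcons_inj[-> ->].
- by move=> s /=; case/lastP: s => // s x; rewrite size_rcons => -[sn]; exists (s, x).
Qed.

Lemma esum_nneseries (T : countType) (a : T -> \bar R) : (forall x, 0 <= a x) ->
  \esum_(x in [set: T]) a x = \sum_(n <oo) oapp a 0 (@pickle_inv T n).
Proof.
move=> a0; rewrite nneseries_esumT; last by move=> n; case: pickle_inv => /=.
rewrite (esumID (range (@pickle T)))/=; last by move=> n _; case: pickle_inv => /=.
rewrite [X in _ + X]esum1 ?adde0; last first.
  move=> n [_]/=; case E : pickle_inv => [x|//] []; exists x => //.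
  by have := @pickle_invK T n; rewrite E.
rewrite setTI esum_image; last by move=> x y _ _; exact: (pcan_inj pickleK).
by apply: eq_esum => x _; rewrite pickleK_inv.
Qed.

(** Dominated convergence for the counting measure on the codes of T. *)
Lemma esum_dominated_cvg (T : countType) (a : nat -> T -> \bar R)
    (b g : T -> \bar R) :
  (forall n x, 0 <= a n x <= g x) -> \esum_(x in [set: T]) g x < +oo ->
  (forall x, a n x @[n --> \oo] --> b x) ->
  \esum_(x in [set: T]) a n x @[n --> \oo] --> \esum_(x in [set: T]) b x.
Proof.
move=> ag gfin ab.
have a0 n x : 0 <= a n x by have /andP[] := ag n x.
have g0 x : 0 <= g x by have /andP[/le_trans] := ag 0%N x; apply.
have b0 x : 0 <= b x.
  rewrite -(cvg_lim _ (ab x))//; apply: lime_ge; last by apply: nearW.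
  by apply/cvg_ex; eexists; exact: ab.
have ext0 (c : T -> \bar R) : (forall x, 0 <= c x) ->
    forall n, 0 <= oapp c 0 (@pickle_inv T n).
  by move=> c0 n; case: pickle_inv => /=.
have esumE (c : T -> \bar R) : (forall x, 0 <= c x) ->
    \esum_(x in [set: T]) c x = \int[counting]_n oapp c 0 (@pickle_inv T n).
  by move=> c0; rewrite esum_nneseries// ge0_integral_count//; exact: ext0.
under eq_fun do rewrite esumE//.
rewrite esumE//.
have gint : counting.-integrable [set: nat] (fun n => oapp g 0 (@pickle_inv T n)).
  apply/integrableP; split => //.
  under eq_integral do rewrite gee0_abs ?ext0//.
  by rewrite -esumE.
have [] // := dominated_convergence (mu := @counting nat R)
  (f_ := fun n m => oapp (a n) 0 (@pickle_inv T m))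
  (f := fun m => oapp b 0 (@pickle_inv T m)) measurableT _ _ _ gint.
- apply: aeW => m _ /=; case: (@pickle_inv T m) => [x|] /=; first exact: ab.
  exact: cvg_cst.
- apply: aeW => m n _; case: (@pickle_inv T m) => [x|] /=; last by rewrite normr0.
  by rewrite gee0_abs//; have /andP[] := ag n x.
Qed.

Lemma esum_dominated_cvg_in (T : countType) (D : set T) (a : nat -> T -> \bar R)
    (b g : T -> \bar R) :
  (forall n x, D x -> 0 <= a n x <= g x) -> \esum_(x in D) g x < +oo ->
  (forall x, D x -> a n x @[n --> \oo] --> b x) ->
  \esum_(x in D) a n x @[n --> \oo] --> \esum_(x in D) b x.
Proof.
rewrite (esum_mkcond D g) (esum_mkcond D b) => ag gfin ab.
under eq_fun do rewrite esum_mkcond.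
apply: esum_dominated_cvg gfin _ => [n x|x]; case: ifPn => [/[1!inE]|_].
- exact: ag.
- by rewrite lexx.
- exact: ab.
- exact: cvg_cst.
Qed.

Lemma esum_graph (T1 T2 C : countType) (f : T1 -> C) (g : T2 -> C) (F : T1 -> T2 -> \bar R) :
  (forall a b, 0 <= F a b) ->
  \esum_(a in [set: T1]) \esum_(b in [set b | g b = f a]) F a b
  = \esum_(x in [set: {x : T1 * T2 | f x.1 == g x.2}]) F (val x).1 (val x).2.
Proof.
move=> F0; rewrite (esum_sig (fun x : T1 * T2 => f x.1 == g x.2) (fun x => F x.1 x.2)) esum_esum//.
rewrite (_ : [set x | _] = [set: T1] `*`` fun a => [set b | g b = f a])//.
by apply/seteqP; split=> [[a b]/= /eqP ->|[a b] [_ /= ->]].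
Qed.

Section CountablyAdditive.
Context d (Om : measurableType d).

(** This covers at once measures and, for a fixed integrand, the dependence of an
    integral on its domain, with no measure structure to declare. *)
Definition countably_additive (m : set Om -> \bar R) :=
  [/\ m set0 = 0, forall D, measurable D -> 0 <= m D &
      forall F : (set Om)^nat, (forall n, measurable (F n)) -> trivIset [set: nat] F ->
        m (\bigcup_n F n) = \sum_(n <oo) m (F n)].

Lemma measure_additive (mu : {measure set Om -> \bar R}) : countably_additive mu.
Proof.
split=> // F mF tF; apply: measure_semi_bigcup => //; exact: bigcup_measurable.
Qed.

Lemma integral_additive (mu : {measure set Om -> \bar R}) (h : Om -> R) :
  measurable_fun [set: Om] h -> (forall w, 0 <= h w)%R ->
  countably_additive (fun D => \int[mu]_(w in D) (h w)%:E).
Proof.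
move=> mh h0; split=> [|D _|F mF tF]; first exact: integral_set0.
  by apply: integral_ge0 => w _; rewrite lee_fin.
apply: ge0_integral_bigcup => //; last by move=> w _; rewrite lee_fin.
by apply/measurable_EFinP; exact: measurable_funTS.
Qed.

Lemma additive_esum (m : set Om -> \bar R) (T : countType) (F : T -> set Om) :
  countably_additive m ->
  (forall x, measurable (F x)) -> trivIset [set: T] F ->
  m (\bigcup_x F x) = \esum_(x in [set: T]) m (F x).
Proof.
move=> [m0 mge0 mU] mF tF; rewrite esum_nneseries => [|x]; last exact: mge0.
pose G n := oapp F set0 (@pickle_inv T n).
have -> : \bigcup_x F x = \bigcup_n G n.
  apply/seteqP; split=> w.
    by move=> [x _ Fx]; exists (pickle x) => //; rewrite /G pickleK_inv.
  by move=> [n _]; rewrite /G; case: pickle_inv => //= x Fx; exists x.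
have Ginv n x : @pickle_inv T n = Some x -> pickle x = n.
  by move=> E; have := @pickle_invK T n; rewrite E.
have mG n : measurable (G n) by rewrite /G; case: pickle_inv => //=.
rewrite mU//=.
  by apply: eq_eseriesr => n _; rewrite /G; case: pickle_inv => //=.
move=> n m' _ _; rewrite /G.
case En : (@pickle_inv T n) => [x|]; last by move=> [? []].
case Em : (@pickle_inv T m') => [y|]; last by move=> [? []].
by rewrite -(Ginv _ _ En) -(Ginv _ _ Em) => /= /tF ->.
Qed.

Lemma additive_compl (m : set Om -> \bar R) (D : set Om) : countably_additive m ->
  measurable D -> m D \is a fin_num -> m (~` D) = m setT - m D.
Proof.
move=> am mD finD; have [_ m0 _] := am.
pose U (b : bool) := if b then D else ~` D.
have mU b : measurable (U b) by case: b => //; exact: measurableC.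
have tU : trivIset setT U by move=> [] [] _ _ [w []]//.
rewrite (_ : setT = \bigcup_b U b); last first.
  by apply/seteqP; split=> // w _; have [Dw|Dw] := pselect (D w); [exists true|exists false].
rewrite (additive_esum am mU tU) (esumID [set true]) => [|b _]; last exact: m0.
rewrite setTI esum_set1; last exact: m0.
rewrite (_ : setT `&` ~` [set true] = [set false]).
  by rewrite esum_set1 ?m0// /U addeC addeK.
by apply/seteqP; split=> [[] [_ nb] //=|_ ->]; [case: nb|split].
Qed.

End CountablyAdditive.

End Sums.

(** * Events of the path space *)

Section PathSpace.
Context {S : countType}.
Implicit Types (E : set (nat -> S)) (Q : set (seq S)).

(** Over all n these events form a pi-system that generates the product
    sigma-algebra. Each is a countable disjoint union of cylinders of length n, and
    two of them always have a common horizon, which spares comparing cylinders of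
    different lengths. *)
Definition horizon n Q : set (nat -> S) := [set x | Q (mkseq x n)].

Lemma path_sigma_algebra : sigma_algebra [set: nat -> S] (@path_measurable S).
Proof. exact: smallest_sigma_algebra. Qed.

Lemma path_measurableC E : path_measurable E -> path_measurable (~` E).
Proof. by case: path_sigma_algebra => _ + _ mE => /(_ _ mE); rewrite setTD. Qed.

Lemma path_measurable_bigcup (T : countType) (F : T -> set (nat -> S)) :
  (forall i, path_measurable (F i)) -> path_measurable (\bigcup_i F i).
Proof.
move=> mF; have [p0 _ pU] := path_sigma_algebra.
have -> : \bigcup_i F i = \bigcup_n oapp F set0 (@pickle_inv T n).
  apply/seteqP; split=> w.
    by move=> [x _ Fx]; exists (pickle x) => //; rewrite pickleK_inv.
  by move=> [n _]; case: pickle_inv => //= x Fx; exists x.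
by apply: pU => n; case: pickle_inv => //=.
Qed.

Lemma path_measurableI E1 E2 :
  path_measurable E1 -> path_measurable E2 -> path_measurable (E1 `&` E2).
Proof.
move=> m1 m2; rewrite -[_ `&` _]setCK setCI; apply: path_measurableC.
rewrite -bigcup2E; have [p0 _ pU] := path_sigma_algebra.
by apply: pU => -[|[|n]] //=; exact: path_measurableC.
Qed.

Lemma path_measurable_coord t (U : set S) : path_measurable [set x | U (x t)].
Proof. by apply: sub_sigma_algebra; exists t, U. Qed.

Lemma path_measurable_horizon n Q : path_measurable (horizon n Q).
Proof.
elim: n Q => [|n IH] Q.
  have [Q0|Q0] := pselect (Q [::]).
    rewrite (_ : horizon _ _ = ~` set0).
      by apply: path_measurableC; case: path_sigma_algebra.
    by apply/seteqP; split => // x _.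
  by rewrite (_ : horizon _ _ = set0); [case: path_sigma_algebra|apply/seteqP; split].
rewrite (_ : horizon _ _ = \bigcup_(a : S)
    (horizon n [set s | Q (rcons s a)] `&` [set x | [set a] (x n)])).
  apply: path_measurable_bigcup => a; apply: path_measurableI; first exact: IH.
  exact: path_measurable_coord.
apply/seteqP; split=> x; rewrite /horizon/= mkseqS; first by exists (x n).
by move=> [a _ [/= + ->]].
Qed.

Lemma horizon_widen n m Q : (n <= m)%N ->
  horizon n Q = horizon m [set s | Q (take n s)].
Proof.
by move=> nm; apply/seteqP; split=> x; rewrite /horizon/= /mkseq -map_take take_iota (minn_idPl nm).
Qed.

(** The pi-lambda theorem for the pi-system of the events of finite horizon. *)
Lemma path_ind (L : set_system (nat -> S)) :
  (forall n Q, L (horizon n Q)) ->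
  (forall E, path_measurable E -> L E -> L (~` E)) ->
  (forall F : (set (nat -> S))^nat, (forall n, path_measurable (F n)) ->
     (forall n, L (F n)) -> trivIset [set: nat] F -> L (\bigcup_n F n)) ->
  forall E, path_measurable E -> L E.
Proof.
move=> Lh LC LU; pose H := [set E | exists n Q, E = horizon n Q].
have HI : setI_closed H.
  move=> _ _ [n [Q ->]] [m [Q' ->]].
  exists (maxn n m), ([set s | Q (take n s)] `&` [set s | Q' (take m s)]).
  rewrite (horizon_widen Q (leq_maxl n m)) (horizon_widen Q' (leq_maxr n m)).
  by apply/seteqP; split.
pose L' := [set E | path_measurable E /\ L E].
have L'd : dynkin L'.
  have [p0 _ pU] := path_sigma_algebra.
  split.
  - rewrite (_ : setT = horizon 0%N setT); first by split; [exact: path_measurable_horizon|exact: Lh].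
    by apply/seteqP; split.
  - by move=> E [mE LE]; split; [exact: path_measurableC|exact: LC].
  - move=> F tF LF; split; first by apply: pU => n; have [] := LF n.
    by apply: LU => // n; have [] := LF n.
move=> E mE; suff [] : L' E by [].
suff : <<d H >> E by apply: smallest_sub => // _ [n [Q ->]]; split;
  [exact: path_measurable_horizon|exact: Lh].
rewrite setI_closed_g_dynkin_g_sigma_algebra//.
move: E mE; apply: smallest_sub; first exact: smallest_sigma_algebra.
move=> _ [t [U ->]]; apply: sub_sigma_algebra.
(* The coordinate t is the last of the first t + 1 letters. *)
exists t.+1, [set s | exists2 a, U a & ohead (rev s) = Some a].
apply/seteqP; split=> x; rewrite /horizon/= mkseqS rev_rcons/=; first by exists (x t).
by move=> [a Ua [->]].
Qed.

End PathSpace.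

Section Processes.
Context {R : realType} d (Om : measurableType d).

Lemma process_measurable (S : countType) (X : nat -> Om -> S) E :
  is_process X -> path_measurable E -> measurable (trajectory X @^-1` E).
Proof.
move=> pX; move: E; apply: smallest_sub.
  split; first by rewrite preimage_set0.
    by move=> E mE; rewrite setTD /mkset preimage_setC; exact: measurableC.
  by move=> F /= mF; rewrite preimage_bigcup; exact: bigcup_measurable.
by move=> _ [t [U ->]]; exact: pX.
Qed.

Lemma process_map (S T : countType) (f : S -> T) (X : nat -> Om -> S) :
  is_process X -> is_process (fun t w => f (X t w)).
Proof. by move=> pX t U; rewrite [X in measurable X](_ : _ = X t @^-1` (f @^-1` U)). Qed.

Lemma path_measurable_map (S T : countType) (f : S -> T) (E : set (nat -> T)) :
  path_measurable E -> path_measurable [set x : nat -> S | E (f \o x)].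
Proof.
move: E; apply: smallest_sub => /=.
  have [p0 _ pU] := @path_sigma_algebra S.
  split => //.
    by move=> E mE; rewrite setTD; exact: (path_measurableC mE).
  move=> F /= mF.
  rewrite (_ : mkset _ = \bigcup_n [set x : nat -> S | F n (f \o x)]); first exact: pU.
  by apply/seteqP; split.
by move=> _ [t [U ->]]; exact: (path_measurable_coord t (f @^-1` U)).
Qed.

Definition prefix_event (S : countType) (X : nat -> Om -> S) (s : seq S) : set Om :=
  [set w | mkseq (trajectory X w) (size s) = s].

Lemma prefix_eventE (S : countType) (X : nat -> Om -> S) (s : seq S) :
  prefix_event X s = trajectory X @^-1` horizon (size s) [set s].
Proof. by []. Qed.

Lemma prefix_event_measurable (S : countType) (X : nat -> Om -> S) (s : seq S) :
  is_process X -> measurable (prefix_event X s).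
Proof. by move=> pX; rewrite prefix_eventE; exact: (process_measurable pX (path_measurable_horizon _ _)). Qed.

Lemma additive_horizon (m : set Om -> \bar R) (S : countType)
    (X : nat -> Om -> S) (D : set Om) n (Q : set (seq S)) :
  countably_additive m -> is_process X -> measurable D ->
  m (trajectory X @^-1` horizon n Q `&` D)
    = \esum_(s in [set s | size s = n /\ Q s]) m (prefix_event X s `&` D).
Proof.
move=> am pX mD; rewrite [RHS]esum_mkcond.
pose F s := if s \in [set s | size s = n /\ Q s] then prefix_event X s `&` D else set0.
have -> : trajectory X @^-1` horizon n Q `&` D = \bigcup_s F s.
  apply/seteqP; split=> w.
    move=> [Qw Dw]; exists (mkseq (trajectory X w) n) => //; rewrite /F ifT ?inE.
      by split => //; rewrite /prefix_event/= size_mkseq.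
    by split => //; rewrite size_mkseq.
  move=> [s _]; rewrite /F; case: ifPn => // /[1!inE] -[sn Qs] [ws Dw]; split => //.
  by rewrite /horizon/= -sn ws.
rewrite additive_esum//.
- by apply: eq_esum => s _; rewrite /F; case: ifPn => // _; have [->] := am.
- by move=> s; rewrite /F; case: ifPn => // _; apply: measurableI => //; exact: prefix_event_measurable.
- move=> s s' _ _ [w []]; rewrite /F; case: ifPn => // /[1!inE] -[sn _] [ws _].
  by case: ifPn => // /[1!inE] -[s'n _] [ws' _]; rewrite -ws -ws' sn s'n.
Qed.

End Processes.

Lemma law_unique (R : realType) (S : countType)
    d1 (Om1 : measurableType d1) (Pr1 : probability Om1 R) (X1 : nat -> Om1 -> S)
    d2 (Om2 : measurableType d2) (Pr2 : probability Om2 R) (X2 : nat -> Om2 -> S) :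
  is_process X1 -> is_process X2 ->
  (forall s, Pr1 (prefix_event X1 s) = Pr2 (prefix_event X2 s)) ->
  eq_law Pr1 X1 Pr2 X2.
Proof.
move=> p1 p2 e; rewrite /eq_law /law; apply: path_ind.
- move=> n Q; rewrite -[X in Pr1 X]setIT -[X in Pr2 X]setIT !additive_horizon//; try exact: measure_additive.
  by apply: eq_esum => s _; rewrite !setIT; exact: e.
- move=> E mE eE.
  have m1 := process_measurable p1 mE; have m2 := process_measurable p2 mE.
  have E1 := probability_setC Pr1 m1; have E2 := probability_setC Pr2 m2.
  by rewrite [LHS]E1 [RHS]E2 eE.
- move=> F mF eF tF; rewrite !preimage_bigcup.
  have sum d (Om : measurableType d) (Pr : probability Om R) (X : nat -> Om -> S) :
      is_process X -> Pr (\bigcup_n (trajectory X @^-1` F n))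
        = \sum_(n <oo) Pr (trajectory X @^-1` F n).
    move=> pX; have mX n : measurable (trajectory X @^-1` F n).
      exact: process_measurable.
    apply: measure_semi_bigcup => //; last exact: bigcup_measurable.
    by move=> n m _ _ [w [Fn Fm]]; apply: (tF n m) => //; exists (trajectory X w).
  rewrite [LHS]sum// [RHS]sum//; apply: eq_eseriesr => n _; exact: eF.
Qed.

(** * Path weights of a Markov chain and of its image *)

Section Weights.
Context {R : realType}.

(** The initial law is the row of a fictitious starting state None, so that
    statements about the first step and about a later step are the same. *)
Definition start_kernel (S : Type) (alpha : S -> R) (P : S -> S -> R)
  : option S -> S -> R := fun o => if o is Some a then P a else alpha.

Fixpoint path_weight (S : Type) (k : option S -> S -> R) (o : option S) (s : seq S) : R :=
  if s is x :: s' then (k o x * path_weight k (Some x) s')%R else 1%R.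

(** The probability that the chain started from o follows, after mapping by f, the
    word s. *)
Fixpoint image_weight (A C : choiceType) (f : A -> C) (k : option A -> A -> R)
    (o : option A) (s : seq C) : \bar R :=
  if s is c :: s' then
    \esum_(a in [set a | f a = c]) ((k o a)%:E * image_weight f k (Some a) s')
  else 1.

Definition end_state (S : Type) (o : option S) (s : seq S) : option S := last o (map Some s).

Definition stochastic_kernel (S : countType) (k : option S -> S -> R) :=
  forall o, prob_vector (k o).

Lemma path_weight_cat (S : Type) (k : option S -> S -> R) o s s' :
  path_weight k o (s ++ s') = (path_weight k o s * path_weight k (end_state o s) s')%R.
Proof. by elim: s o => [|x s IH] o /=; rewrite ?mul1r// IH mulrA. Qed.

Lemma path_weight_rcons (S : Type) (k : option S -> S -> R) o s x :
  path_weight k o (rcons s x) = (path_weight k o s * k (end_state o s) x)%R.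
Proof. by rewrite -cats1 path_weight_cat/= mulr1. Qed.

Lemma end_state_rcons (S : Type) (o : option S) s x : end_state o (rcons s x) = Some x.
Proof. by rewrite /end_state map_rcons last_rcons. Qed.

Lemma end_state_map (S T : Type) (f : S -> T) (o : option S) s :
  end_state (omap f o) (map f s) = omap f (end_state o s).
Proof. by rewrite /end_state -map_comp -(last_map (omap f)) -map_comp. Qed.

Section Stochastic.
Context {A C : countType} (f : A -> C) (k : option A -> A -> R).
Hypothesis hk : stochastic_kernel k.

Let k0 o a : (0 <= k o a)%R. Proof. by have [] := hk o. Qed.

Lemma path_weight_ge0 o s : (0 <= path_weight k o s)%R.
Proof. by elim: s o => //= x s IH o; rewrite mulr_ge0. Qed.

Lemma sum_path_weight_rcons o s :
  \esum_(x in [set: A]) (path_weight k o (rcons s x))%:E = (path_weight k o s)%:E.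
Proof.
under eq_esum do rewrite path_weight_rcons EFinM.
rewrite esumZl ?path_weight_ge0//; first by have [_ ->] := hk (end_state o s); rewrite mule1.
by move=> a _; rewrite lee_fin.
Qed.

Lemma image_weight_ge0 o s : 0 <= image_weight f k o s.
Proof. by elim: s o => //= c s IH o; apply: esum_ge0 => a _; rewrite mule_ge0// lee_fin. Qed.
Hint Resolve image_weight_ge0 : core.

Lemma sum_image_weight o n :
  \esum_(s in [set s | size s = n]) image_weight f k o s = 1.
Proof.
elim: n o => [|n IH] o; first by rewrite esum_size0.
rewrite esum_cons//=.
transitivity (\esum_(c in [set: C]) \esum_(a in [set a | setT a /\ f a = c]) (k o a)%:E).
  apply: eq_esum => c _; rewrite esum_swap; last by move=> s a _ _; rewrite mule_ge0// lee_fin.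
  rewrite (_ : [set a | _] = [set a | setT a /\ f a = c]); last by apply/seteqP; split=> [a|a []].
  apply: eq_esum => a _; rewrite esumZl//; by rewrite IH mule1.
rewrite (@esum_fibers _ _ _ _ f) => [|a _]; last by rewrite lee_fin.
by have [] := hk o.
Qed.

Lemma image_weight_fin o s : image_weight f k o s \is a fin_num.
Proof.
rewrite ge0_fin_numE// (@le_lt_trans _ _ 1) ?ltry//.
by rewrite -(sum_image_weight o (size s)); exact: le_esum_term.
Qed.

Lemma sum_image_weight_rcons o s :
  \esum_(c in [set: C]) image_weight f k o (rcons s c) = image_weight f k o s.
Proof.
elim: s o => [|c s IH] o /=.
  transitivity (\esum_(c in [set: C]) \esum_(a in [set a | setT a /\ f a = c]) (k o a)%:E).
    apply: eq_esum => c _.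
    rewrite (_ : [set a | _] = [set a | setT a /\ f a = c]); last by apply/seteqP; split=> [a|a []].
    by apply: eq_esum => a _; rewrite mule1.
  rewrite (@esum_fibers _ _ _ _ f) => [|a _]; last by rewrite lee_fin.
  by have [] := hk o.
rewrite esum_swap; last by move=> s' a _ _; rewrite mule_ge0// lee_fin.
by apply: eq_esum => a _; rewrite esumZl// IH.
Qed.

(** To follow c ++ s after mapping, first follow one of the paths y above c, then s
    from the end of y. *)
Lemma sum_lifted_paths o c s :
  \esum_(y in [set y | map f y = c])
     ((path_weight k o y)%:E * image_weight f k (end_state o y) s)
    = image_weight f k o (c ++ s).
Proof.
elim: c o => [|c0 c IH] o.
  rewrite (_ : [set y | _] = [set [::]]) ?esum_set1 ?mul1e ?mule_ge0 ?lee_fin//.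
  by apply/seteqP; split=> [[]|? ->].
rewrite /=; under [RHS]eq_esum => a _.
  rewrite -IH -esumZl ?k0//; last by move=> y _; rewrite mule_ge0// lee_fin path_weight_ge0.
  over.
rewrite esum_esum; last first.
  by move=> a y _ _; rewrite mule_ge0 ?lee_fin// mule_ge0// lee_fin path_weight_ge0.
rewrite (reindex_esum ([set a | f a = c0] `*`` fun=> [set y | map f y = c]) _
  (fun ay => ay.1 :: ay.2)) /=.
  by apply: eq_esum => -[a y] _ /=; rewrite EFinM muleA.
split=> /=.
- by move=> [a y] [/= -> ->].
- by move=> [a y] [a' y'] /= _ _ [-> ->].
- by move=> [//|a y] /= [ac yc]; exists (a, y).
Qed.

End Stochastic.
End Weights.

Section ChainLaw.
Context {R : realType} d (Om : measurableType d) (Pr : probability Om R).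

(** This is equivalent to [is_MC] for the kernel of an initial law and a transition
    matrix ([MC_path_law], [path_law_MC]), but free of conditional probabilities. *)
Definition has_path_law (S : countType) (k : option S -> S -> R) (X : nat -> Om -> S) :=
  is_process X /\ forall s, Pr (prefix_event X s) = (path_weight k None s)%:E.

Lemma prefix_event_rcons (S : countType) (X : nat -> Om -> S) s x :
  prefix_event X (rcons s x) = prefix_event X s `&` [set w | X (size s) w = x].
Proof.
apply/seteqP; split=> w; rewrite /prefix_event/= size_rcons mkseqS.
  by move=> /rcons_inj[].
by move=> [-> <-].
Qed.

(** A past of probability zero, about which [is_MC] says nothing, has weight zero,
    so the product formula persists there. *)
Lemma MC_path_law (S : countType) alpha P (X : nat -> Om -> S) :
  is_MC Pr alpha P X -> has_path_law (start_kernel alpha P) X.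
Proof.
move=> [pa sP pX hi ht]; split => //; elim/last_ind => [|s x IH].
  rewrite /prefix_event/= -(@probability_setT _ _ _ Pr); congr (Pr _).
  by apply/seteqP; split.
rewrite path_weight_rcons prefix_event_rcons.
case/lastP: s IH => [|s y] IH.
  rewrite /= mul1r -hi; congr (Pr _).
  by apply/seteqP; split=> w //= [].
have /= := ht (size s) (nth x (rcons (rcons s y) x)).
rewrite !nth_rcons !size_rcons ltnn eqxx ltnSn ltnn eqxx.
have -> : [set w | forall i, (i <= size s)%N ->
    X i w = nth x (rcons (rcons s y) x) i] = prefix_event X (rcons s y).
  apply/seteqP; split=> w; rewrite /prefix_event/=.
    move=> h; apply: (@eq_from_nth _ x); rewrite size_mkseq// => i; rewrite size_rcons => ilt.
    by rewrite nth_mkseq// /trajectory h// nth_rcons size_rcons ilt.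
  move=> <- i ilt; rewrite nth_rcons size_mkseq size_rcons ltnS ilt nth_mkseq//.
have fB : Pr (prefix_event X (rcons s y)) \is a fin_num by rewrite IH.
have mB : measurable (prefix_event X (rcons s y)) by exact: prefix_event_measurable.
have mA : measurable [set w | X (size s).+1 w = x] by exact: (pX _ [set x]).
have [B0 _|B0] := eqVneq (Pr (prefix_event X (rcons s y))) 0.
  have -> : path_weight (start_kernel alpha P) None (rcons s y) = 0%R.
    by apply: EFin_inj; rewrite -IH.
  have le0 : Pr (prefix_event X (rcons s y) `&` [set w | X (size s).+1 w = x]) <= 0.
    by rewrite -B0; apply: le_measure; rewrite ?inE//; exact: measurableI.
  by rewrite mul0r; apply/eqP; rewrite eq_le measure_ge0 andbT.
rewrite lt0e B0 measure_ge0 => /(_ isT); rewrite end_state_rcons /cond_prob setIC IH/= => <-.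
have p0 : path_weight (start_kernel alpha P) None (rcons s y) != 0%R.
  by apply: contra B0 => /eqP p0; rewrite IH p0.
rewrite mulrC divfK// fineK//.
rewrite ge0_fin_numE// (@le_lt_trans _ _ (Pr setT)) ?probability_setT ?ltry//.
by rewrite -(@probability_setT _ _ _ Pr) le_measure ?inE//; exact: measurableI.
Qed.

(** By induction on s, splitting according to the next state of X, one of those
    above the next letter. *)
Lemma image_path_law (A C : countType) (f : A -> C) k (X : nat -> Om -> A) x s :
  stochastic_kernel k -> has_path_law k X ->
  Pr (prefix_event X x `&` prefix_event (fun t w => f (X t w)) (map f x ++ s))
    = (path_weight k None x)%:E * image_weight f k (end_state None x) s.
Proof.
move=> hk [pX hX].
have pfX : is_process (fun t w => f (X t w)) by exact: process_map.
elim: s x => [|c s IH] x.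
  rewrite mule1 -hX cats0; congr (Pr _); apply/seteqP; split=> w; first by case.
  rewrite /prefix_event/= => xw; split => //.
  by rewrite -[in RHS]xw size_map /mkseq -map_comp.
pose F a := if f a == c then prefix_event X (rcons x a) `&`
   prefix_event (fun t w => f (X t w)) (map f (rcons x a) ++ s) else set0.
have -> : prefix_event X x `&` prefix_event (fun t w => f (X t w)) (map f x ++ c :: s)
    = \bigcup_a F a.
  apply/seteqP; split=> w.
    move=> [xw cw]; have cX : f (X (size x) w) = c.
      move: cw; rewrite /prefix_event/= => /(congr1 (nth c ^~ (size x))).
      rewrite nth_cat size_map ltnn subnn/= nth_mkseq//.
      by rewrite size_cat size_map/= addnS ltnS leq_addr.
    exists (X (size x) w) => //; rewrite /F cX eqxx prefix_event_rcons map_rcons cX.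
    by rewrite cat_rcons.
  move=> [a _]; rewrite /F; case: eqP => // <-; rewrite prefix_event_rcons map_rcons cat_rcons.
  by move=> [[]].
rewrite additive_esum; first last.
- move=> a b _ _ [w []]; rewrite /F; case: eqP => // _ [+ _]; case: eqP => // _.
  by rewrite !prefix_event_rcons => -[_ /= aw] [[_ /= bw] _]; rewrite -aw -bw.
- by move=> a; rewrite /F; case: ifP => // _; apply: measurableI; exact: prefix_event_measurable.
- exact: measure_additive.
have iw0 := image_weight_ge0 f hk.
rewrite -esumZl ?path_weight_ge0//; last first.
  by move=> a _; rewrite mule_ge0// lee_fin; have [] := hk (end_state None x).
rewrite [RHS]esum_mkcond; apply: eq_esum => a _; rewrite /F.
case: eqP => fa; last by rewrite ifF ?measure0//; apply/negbTE; rewrite notin_setE.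
by rewrite [LHS](IH (rcons x a)) path_weight_rcons end_state_rcons EFinM muleA ifT// inE.
Qed.

End ChainLaw.

(** * Pairing of two bounded density martingales *)

Section Pairing.
Context {R : realType} {C : countType} (q : seq C -> R).
Implicit Types u v : seq C -> R.

(** The masses that a measure with density at most K with respect to q gives to the
    cylinders. *)
Definition bounded_density (K : R) u :=
  [/\ (0 <= K)%R, forall s, (0 <= u s <= K * q s)%R &
      forall s, \esum_(c in [set: C]) (u (rcons s c))%:E = (u s)%:E].

(** The expectation under q of the product of the densities u / q and v / q
    along the first n letters; words of q-weight zero contribute nothing. *)
Definition pairing u v n : \bar R :=
  \esum_(s in [set s | size s = n]) (u s * v s / q s)%:E.

Hypothesis hq : bounded_density 1 q.

Let q0 s : (0 <= q s)%R. Proof. by have [_ /(_ s)/andP[]] := hq. Qed.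

Lemma pairingC u v n : pairing u v n = pairing v u n.
Proof. by apply: eq_esum => s _; rewrite [(u s * _)%R]mulrC. Qed.

Lemma sum_bounded_density K u n : bounded_density K u ->
  \esum_(s in [set s | size s = n]) (u s)%:E = (u [::])%:E.
Proof.
move=> [_ uK us]; have u0 s : (0 <= u s)%R by have /andP[] := uK s.
elim: n => [|n IH]; first by rewrite esum_size0 ?lee_fin.
rewrite esum_rcons; last by move=> s; rewrite lee_fin.
by rewrite -IH; apply: eq_esum.
Qed.

Lemma bounded_densityD K L u v : bounded_density K u -> bounded_density L v ->
  bounded_density (K + L) (fun s => u s + v s)%R.
Proof.
move=> [K0 uK us] [L0 vL vs]; split; first exact: addr_ge0.
  move=> s; have /andP[u0 uKs] := uK s; have /andP[v0 vLs] := vL s.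
  by rewrite addr_ge0//= mulrDl lerD.
move=> s; under eq_esum do rewrite EFinD.
rewrite esumD ?us ?vs// => c _; rewrite lee_fin; first by have /andP[] := uK (rcons s c).
by have /andP[] := vL (rcons s c).
Qed.

Lemma pairing_ge0 K L u v n : bounded_density K u -> bounded_density L v ->
  0 <= pairing u v n.
Proof.
move=> [_ uK _] [_ vL _]; apply: esum_ge0 => s _; rewrite lee_fin.
by have /andP[? _] := uK s; have /andP[? _] := vL s; rewrite !mulr_ge0// invr_ge0.
Qed.

(** Also where q s = 0, the quotient being then 0. *)
Lemma density_le K u s : bounded_density K u -> (u s / q s <= K)%R.
Proof.
move=> [K0 /(_ s)/andP[u0 uK] _]; have := q0 s; rewrite le_eqVlt => /orP[/eqP<-|qs].
  by rewrite invr0 mulr0.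
by rewrite ler_pdivrMr.
Qed.

Lemma pairing_le K L u v n : bounded_density K u -> bounded_density L v ->
  pairing u v n <= (K * v [::])%:E.
Proof.
move=> hu hv; have [K0 _ _] := hu; have [_ vL _] := hv.
rewrite EFinM -(sum_bounded_density n hv) -esumZl//; last first.
  by move=> s _; rewrite lee_fin; have /andP[] := vL s.
apply: le_esum => s _; rewrite lee_fin mulrAC ler_wpM2r//; first by have /andP[] := vL s.
exact: density_le hu.
Qed.

(** The energy of a density martingale increases: this is the Cauchy-Schwarz
    inequality, obtained by summing over the next letter the tangent inequality
    2 l x <= x^2 / y + l^2 y, with the slope l equal to the current density. *)
Lemma pairing_nondecreasing K u : bounded_density K u ->
  nondecreasing_seq (pairing u u).
Proof.
move=> hu; have [K0 uK us] := hu; have [_ _ qs] := hq.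
have u0 s : (0 <= u s)%R by have /andP[] := uK s.
have t0 s : (0 <= u s * u s / q s)%R by rewrite !mulr_ge0// invr_ge0.
apply/nondecreasing_seqP => n; rewrite /pairing esum_rcons; last by move=> s; rewrite lee_fin.
apply: le_esum => s _.
set l := (u s / q s)%R; have l0 : (0 <= l)%R by rewrite divr_ge0.
have le2 : \esum_(c in [set: C]) (2 * l * u (rcons s c))%:E <=
    \esum_(c in [set: C]) ((u (rcons s c) * u (rcons s c) / q (rcons s c))%:E
       + (l ^+ 2 * q (rcons s c))%:E).
  apply: le_esum => c _; rewrite -EFinD lee_fin.
  have := q0 (rcons s c); rewrite le_eqVlt => /orP[/eqP qc|qc].
    have /andP[_] := uK (rcons s c); rewrite -qc mulr0 => uc.
    have -> : u (rcons s c) = 0%R by apply/eqP; rewrite eq_le uc u0.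
    by rewrite !mulr0 !mul0r addr0.
  set x := u _; set y := q _ in qc *.
  have -> : (x * x / y + l ^+ 2 * y = 2 * l * x + (x - l * y) ^+ 2 / y)%R.
    by field; rewrite gt_eqF.
  by rewrite lerDl divr_ge0// ?sqr_ge0// ltW.
rewrite esumD in le2; last 2 first.
- by move=> c _; rewrite lee_fin.
- by move=> c _; rewrite lee_fin mulr_ge0// sqr_ge0.
have l20 : (0 <= 2 * l)%R by apply: mulr_ge0.
have e1 : \esum_(c in [set: C]) (2 * l * u (rcons s c))%:E = (2 * l * u s)%:E.
  under eq_esum do rewrite EFinM.
  by rewrite esumZl ?us ?EFinM// => c _; rewrite lee_fin.
have e2 : \esum_(c in [set: C]) (l ^+ 2 * q (rcons s c))%:E = (l ^+ 2 * q s)%:E.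
  under eq_esum do rewrite EFinM.
  by rewrite esumZl ?qs ?EFinM// ?sqr_ge0// => c _; rewrite lee_fin.
rewrite e1 e2 -leeBlDr// in le2; apply: le_trans le2; rewrite -EFinB lee_fin.
have := q0 s; rewrite le_eqVlt => /orP[/eqP qs0|qs0].
  by rewrite /l -qs0 invr0 !mulr0 !(mulr0, mul0r, subr0).
by rewrite le_eqVlt; apply/orP; left; apply/eqP; rewrite /l; field; rewrite gt_eqF.
Qed.

(** By polarization, from the convergence of the bounded increasing energies of
    u, v and u + v. *)
Lemma pairing_cvg K L u v : bounded_density K u -> bounded_density L v ->
  exists l : R, pairing u v n @[n --> \oo] --> l%:E.
Proof.
move=> hu hv; have huv := bounded_densityD hu hv.
have fin M w n : bounded_density M w -> pairing w w n \is a fin_num.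
  move=> hw; rewrite ge0_fin_numE; last exact: (pairing_ge0 n hw hw).
  by apply: le_lt_trans (pairing_le n hw hw) _; rewrite ltry.
have conv M w : bounded_density M w ->
    exists l : R, fine (pairing w w n) @[n --> \oo] --> l.
  move=> hw; suff : cvgn (fun n => fine (pairing w w n)).
    by move=> /cvg_ex[l ?]; exists l.
  apply: nondecreasing_is_cvgn.
    apply/nondecreasing_seqP => n; rewrite fine_le ?(fin _ _ _ hw)//.
    by apply/nondecreasing_seqP: n; exact: pairing_nondecreasing hw.
  exists (M * w [::])%R => _ [n _ <-].
  by rewrite -lee_fin fineK ?(fin _ _ _ hw)//; exact: (pairing_le n hw hw).
have [lu cu] := conv _ _ hu; have [lv cv] := conv _ _ hv; have [luv cuv] := conv _ _ huv.
exists (2^-1 * (luv - lu - lv))%R.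
have [_ uK _] := hu; have [_ vL _] := hv.
have u0 s : (0 <= u s)%R by have /andP[] := uK s.
have v0 s : (0 <= v s)%R by have /andP[] := vL s.
have qi0 s : (0 <= (q s)^-1)%R by rewrite invr_ge0.
have fuv n : pairing u v n \is a fin_num.
  rewrite ge0_fin_numE; last exact: (pairing_ge0 n hu hv).
  by apply: le_lt_trans (pairing_le n hu hv) _; rewrite ltry.
have e n : pairing u v n = (2^-1 * (fine (pairing (fun s => u s + v s)%R (fun s => u s + v s)%R n)
     - fine (pairing u u n) - fine (pairing v v n)))%:E.
  have -> : pairing (fun s => u s + v s)%R (fun s => u s + v s)%R n =
      pairing u u n + (pairing u v n + pairing u v n + pairing v v n).
    rewrite /pairing -!esumD => [|s _|s _|s _|s _|s _|s _];
      rewrite ?adde_ge0 ?lee_fin ?mulr_ge0//.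
    by apply: eq_esum => s _; rewrite -!EFinD; congr EFin; ring.
  rewrite -[in LHS](fineK (fuv n)) !fineD ?fin_numD ?fuv ?(fin _ _ _ hu) ?(fin _ _ _ hv)//.
  by congr EFin; field.
rewrite (funext e).
apply: cvg_EFin; first by apply: nearW.
by apply: cvgMr; apply: cvgB => //; exact: cvgB.
Qed.

End Pairing.

(** * The harmonic function of two chains with a common image *)

Section Overlap.
Context {R : realType} {A B C : countType} (f : A -> C) (g : B -> C).
Context (kX : option A -> A -> R) (kY : option B -> B -> R) (kZ : option C -> C -> R).

Definition image_density (S : countType) (h : S -> C) (k : option S -> S -> R) o s : R :=
  fine (image_weight h k o s).

(** Each starting state sees, after mapping, a future law with bounded density
    with respect to the chain with kernel kZ. *)
Definition dominated_image (S : countType) (h : S -> C) (k : option S -> S -> R) :=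
  forall o, exists2 K : R, (0 <= K)%R &
    forall s, (image_density h k o s <= K * path_weight kZ (omap h o) s)%R.

(** At the two states of a pair in Delta this is an entry of R^n 1; at the two
    starting states it is 1 once the image laws coincide ([overlap_start]). *)
Definition overlap n oa ob : \bar R :=
  pairing (path_weight kZ (omap f oa)) (image_density f kX oa) (image_density g kY ob) n.

(** The value is significant only for states with the same image. *)
Definition overlap_lim oa ob : R := fine (limn (fun n => overlap n oa ob)).

End Overlap.

Section OverlapTheory.
Context {R : realType} {A B C : countType} {f : A -> C} {g : B -> C}.
Context {kX : option A -> A -> R} {kY : option B -> B -> R} {kZ : option C -> C -> R}.
Hypotheses (sX : stochastic_kernel kX) (sY : stochastic_kernel kY) (sZ : stochastic_kernel kZ).
Hypotheses (dX : dominated_image kZ f kX) (dY : dominated_image kZ g kY).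

Lemma image_densityE (S : countType) (h : S -> C) (k : option S -> S -> R) o s :
  stochastic_kernel k -> (image_density h k o s)%:E = image_weight h k o s.
Proof. by move=> hk; rewrite fineK// image_weight_fin. Qed.

Lemma path_weight_density (k : option C -> C -> R) o :
  stochastic_kernel k -> bounded_density (path_weight k o) 1 (path_weight k o).
Proof.
move=> hk; split=> // [s|s]; first by rewrite mul1r lexx path_weight_ge0.
exact: sum_path_weight_rcons.
Qed.

Lemma image_density_bounded (S : countType) (h : S -> C) (k : option S -> S -> R) o :
  stochastic_kernel k -> dominated_image kZ h k ->
  exists K, bounded_density (path_weight kZ (omap h o)) K (image_density h k o).
Proof.
move=> hk /(_ o)[K K0 dK]; exists K; split=> // s.
  by rewrite dK andbT -lee_fin image_densityE// image_weight_ge0.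
under eq_esum do rewrite image_densityE//.
by rewrite sum_image_weight_rcons// image_densityE.
Qed.

Let uX := image_density f kX.
Let uY := image_density g kY.
Let q := path_weight kZ.
Let Phi := overlap f g kX kY kZ.
Let phi := overlap_lim f g kX kY kZ.

Let uX0 o s : (0 <= uX o s)%R. Proof. by rewrite -lee_fin image_densityE// image_weight_ge0. Qed.
Let uY0 o s : (0 <= uY o s)%R. Proof. by rewrite -lee_fin image_densityE// image_weight_ge0. Qed.
Let q0 o s : (0 <= q o s)%R. Proof. exact: path_weight_ge0. Qed.
Let kX0 o a : (0 <= kX o a)%R. Proof. by have [] := sX o. Qed.
Let kY0 o a : (0 <= kY o a)%R. Proof. by have [] := sY o. Qed.
Let kZ0 o a : (0 <= kZ o a)%R. Proof. by have [] := sZ o. Qed.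

Lemma overlap_ge0 n oa ob : 0 <= Phi n oa ob.
Proof. by apply: esum_ge0 => s _; rewrite lee_fin !mulr_ge0// invr_ge0 q0. Qed.

Lemma overlap_le oa : exists2 K : R, (0 <= K)%R & forall n ob,
  omap f oa = omap g ob -> Phi n oa ob <= K%:E.
Proof.
have [K hu] := image_density_bounded oa sX dX; exists K; first by case: hu.
move=> n ob e; have [L hv] := image_density_bounded ob sY dY; rewrite -e in hv.
have := pairing_le (path_weight_density (omap f oa) sZ) n hu hv.
by rewrite /image_density/= mulr1.
Qed.

Lemma overlap_cvg oa ob : omap f oa = omap g ob ->
  Phi n oa ob @[n --> \oo] --> (phi oa ob)%:E.
Proof.
move=> e; have [K hu] := image_density_bounded oa sX dX.
have [L hv] := image_density_bounded ob sY dY; rewrite -e in hv.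
have [l cl] := pairing_cvg (path_weight_density (omap f oa) sZ) hu hv.
suff -> : phi oa ob = l by exact: cl.
by rewrite /phi /overlap_lim (_ : limn _ = l%:E)//; apply/cvg_lim.
Qed.

Lemma overlap_lim_ge0 oa ob : (0 <= phi oa ob)%R.
Proof.
rewrite fine_ge0//; have [cv|ncv] := pselect (cvgn (fun n => Phi n oa ob)).
  by apply: lime_ge => //; apply: nearW => n; exact: overlap_ge0.
by rewrite dvgP.
Qed.

Lemma overlap_fin n oa ob : omap f oa = omap g ob -> Phi n oa ob \is a fin_num.
Proof.
move=> e; have [K _ le] := overlap_le oa; rewrite ge0_fin_numE ?overlap_ge0//.
by apply: le_lt_trans (le n _ e) _; rewrite ltry.
Qed.

(** From a pair of states this is an entry of R; from the starting states it is
    alpha_X(a) alpha_Y(b) / alpha_Z(f a). *)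
Definition step_ratio oa ob a b : R := (kX oa a * kY ob b / kZ (omap f oa) (f a))%R.

Let step_ratio0 oa ob a b : (0 <= step_ratio oa ob a b)%R.
Proof. by rewrite !mulr_ge0// invr_ge0. Qed.

(* The summand of the overlap along the word (f a) :: s restricted to the
   first steps a and b. *)
Let term oa ob a b s : \bar R :=
  (kX oa a * kY ob b * uX (Some a) s * uY (Some b) s / q (omap f oa) (f a :: s))%:E.

Let term0 oa ob a b s : 0 <= term oa ob a b s.
Proof. by rewrite lee_fin mulr_ge0 ?invr_ge0 ?q0// !mulr_ge0. Qed.

Let step_overlap oa ob a b n :
  (step_ratio oa ob a b)%:E * Phi n (Some a) (Some b)
    = \esum_(s in [set s | size s = n]) term oa ob a b s.
Proof.
rewrite -esumZl//; last by move=> s _; rewrite lee_fin !mulr_ge0// invr_ge0 q0.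
apply: eq_esum => s _; rewrite -EFinM; congr EFin.
rewrite /step_ratio /q/= -/uX -/uY invfM; ring.
Qed.

Let image_density_cons (S : countType) (h : S -> C) (k : option S -> S -> R) o c s (r : R) :
  stochastic_kernel k -> (0 <= r)%R ->
  (image_density h k o (c :: s) * r)%:E
   = \esum_(a in [set a | h a = c]) (k o a * image_density h k (Some a) s * r)%:E.
Proof.
move=> hk r0; have k0 a : (0 <= k o a)%R by have [] := hk o.
have d0 a : (0 <= image_density h k (Some a) s)%R.
  by rewrite -lee_fin image_densityE// image_weight_ge0.
rewrite mulrC EFinM image_densityE//= -esumZl//; last first.
  by move=> a _; rewrite mule_ge0 ?lee_fin// image_weight_ge0.
by apply: eq_esum => a _; rewrite -image_densityE// -!EFinM mulrC.
Qed.

Let image_density_step (S : countType) (h : S -> C) (k : option S -> S -> R) o a s :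
  stochastic_kernel k ->
  (k o a * image_density h k (Some a) s <= image_density h k o (h a :: s))%R.
Proof.
move=> hk; have k0 a' : (0 <= k o a')%R by have [] := hk o.
have d0 a' : (0 <= image_density h k (Some a') s)%R.
  by rewrite -lee_fin image_densityE// image_weight_ge0.
have := image_density_cons h o (h a) s hk (@ler01 R); rewrite mulr1 -lee_fin => ->.
under eq_esum do rewrite mulr1.
by apply: le_esum_term => // a' _; rewrite lee_fin mulr_ge0.
Qed.

(** Expand both densities according to the states a and b above the first letter of
    the word. *)
Lemma overlapS n oa ob : omap f oa = omap g ob ->
  Phi n.+1 oa ob = \esum_(a in [set: A]) \esum_(b in [set b | g b = f a])
     ((step_ratio oa ob a b)%:E * Phi n (Some a) (Some b)).
Proof.
move=> e; rewrite {1}/Phi {1}/overlap {1}/pairing esum_cons; last first.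
  by move=> s; rewrite lee_fin !mulr_ge0// invr_ge0 q0.
under [RHS]eq_esum do under eq_esum do rewrite step_overlap.
rewrite -(@esum_fibers _ _ _ setT f); last by move=> a _; do 2!apply: esum_ge0 => ? _.
apply: eq_esum => c _; rewrite (_ : [set x | _] = [set a | f a = c]); last first.
  by apply/seteqP; split=> [a []|a].
transitivity (\esum_(s in [set s | size s = n]) \esum_(a in [set a | f a = c])
   \esum_(b in [set b | g b = f a]) term oa ob a b s).
  apply: eq_esum => s _.
  have qi w : (0 <= (q (omap f oa) w)^-1)%R by rewrite invr_ge0 q0.
  rewrite -mulrA image_density_cons ?mulr_ge0//; apply: eq_esum => a /= <-.
  rewrite mulrCA image_density_cons//; last first.
    by apply: mulr_ge0; [apply: mulr_ge0; [exact: kX0|exact: uX0]|exact: (qi (f a :: s))].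
  by apply: eq_esum => b _; congr EFin; rewrite -/uX -/uY -/q; ring.
rewrite esum_swap; last by move=> s a _ _; apply: esum_ge0.
by apply: eq_esum => a _; rewrite esum_swap.
Qed.


(** Summing over the second coordinate of the first step restores the second
    process: uniformly in the horizon, the mass of first steps to a is at most
    a constant times kX oa a. This is what makes the recursion pass to the limit. *)
Lemma step_overlap_sum_le oa ob : omap f oa = omap g ob ->
  exists2 L : R, (0 <= L)%R & forall n a,
    \esum_(b in [set b | g b = f a]) ((step_ratio oa ob a b)%:E * Phi n (Some a) (Some b))
      <= (L * kX oa a)%:E.
Proof.
move=> e; have [L hv] := image_density_bounded ob sY dY; have [L0 _ _] := hv.
exists L => // n a.
under eq_esum do rewrite step_overlap.
rewrite esum_swap//.
have -> : (L * kX oa a)%:E = \esum_(s in [set s | size s = n]) (L * kX oa a * uX (Some a) s)%:E.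
  under [RHS]eq_esum do rewrite EFinM image_densityE//.
  rewrite esumZl ?mulr_ge0 ?sum_image_weight ?mule1// => s _.
  exact: image_weight_ge0.
apply: le_esum => s _.
have r0 : (0 <= kX oa a * uX (Some a) s / q (omap f oa) (f a :: s))%R.
  apply: mulr_ge0; first exact: mulr_ge0.
  by rewrite invr_ge0 q0.
rewrite (_ : esum _ _ = (uY ob (f a :: s) * (kX oa a * uX (Some a) s / q (omap f oa) (f a :: s)))%:E).
  rewrite lee_fin [leLHS](_ : _ = (uY ob (f a :: s) / q (omap f oa) (f a :: s)) * (kX oa a * uX (Some a) s))%R; last by ring.
  rewrite -[leRHS]mulrA ler_wpM2r ?mulr_ge0//; rewrite e.
  exact: (density_le (path_weight_density _ sZ) (f a :: s) hv).
rewrite image_density_cons//; apply: eq_esum => b _; congr EFin.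
by rewrite /q /uX /uY; ring.
Qed.

(** The bound for a fixed first step, obtained from the density of the first
    process; it is summable in b. *)
Lemma step_overlap_le oa ob : omap f oa = omap g ob ->
  exists2 K : R, (0 <= K)%R & forall n a b, g b = f a ->
    (step_ratio oa ob a b)%:E * Phi n (Some a) (Some b) <= (K * kY ob b)%:E.
Proof.
move=> e; have [K hu] := image_density_bounded oa sX dX; have [K0 _ _] := hu.
exists K => // n a b gb; rewrite step_overlap.
have -> : (K * kY ob b)%:E = \esum_(s in [set s | size s = n]) (K * kY ob b * uY (Some b) s)%:E.
  under [RHS]eq_esum do rewrite EFinM image_densityE//.
  rewrite esumZl ?mulr_ge0 ?sum_image_weight ?mule1// => s _.
  exact: image_weight_ge0.
apply: le_esum => s _; rewrite lee_fin -[leRHS]mulrA.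
rewrite [leLHS](_ : _ = (kX oa a * uX (Some a) s / q (omap f oa) (f a :: s)) * (kY ob b * uY (Some b) s))%R; last by ring.
rewrite ler_wpM2r ?mulr_ge0//.
apply: le_trans (density_le (path_weight_density _ sZ) (f a :: s) hu).
by rewrite ler_wpM2r ?image_density_step// invr_ge0 q0.
Qed.

Let sum_kernel (S : countType) (k : option S -> S -> R) o (L : R) : stochastic_kernel k ->
  (0 <= L)%R -> \esum_(a in [set: S]) (L * k o a)%:E < +oo.
Proof.
move=> hk L0; under eq_esum do rewrite EFinM.
have [k0 k1] := hk o.
by rewrite esumZl// => [|a _]; rewrite ?lee_fin// k1 mule1 ltry.
Qed.

(** Dominated convergence in the recursion for the overlaps: for fixed a in the sum
    over b, then in the sum over a. A single bound for the pairs (a, b) need not be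
    summable. *)
Lemma overlap_lim_step oa ob : omap f oa = omap g ob ->
  \esum_(a in [set: A]) \esum_(b in [set b | g b = f a])
     ((step_ratio oa ob a b)%:E * (phi (Some a) (Some b))%:E) = (phi oa ob)%:E.
Proof.
move=> e; have [L L0 dL] := step_overlap_sum_le e; have [K K0 dK] := step_overlap_le e.
have t0 n a b : 0 <= (step_ratio oa ob a b)%:E * Phi n (Some a) (Some b).
  by rewrite mule_ge0 ?overlap_ge0// lee_fin.
apply: (@cvg_unique _ (@ereal_hausdorff R) (fmap (fun n => Phi n.+1 oa ob) \oo)); last first.
  by have := overlap_cvg e; rewrite -(cvg_shiftS (fun n => Phi n oa ob)).
rewrite (_ : (fun n => _) = fun n => \esum_(a in [set: A]) \esum_(b in [set b | g b = f a])
     ((step_ratio oa ob a b)%:E * Phi n (Some a) (Some b))); last first.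
  by apply/funext => n; exact: overlapS.
apply: esum_dominated_cvg (sum_kernel oa sX L0) _ => [n a|a].
  by rewrite dL andbT; apply: esum_ge0.
apply: (@esum_dominated_cvg_in _ _ _ _ _ (fun b => (K * kY ob b)%:E)).
- by move=> n b /= gb; rewrite t0/= dK.
- rewrite esum_mkcond; apply: le_lt_trans (sum_kernel ob sY K0); apply: le_esum => b _.
  by case: ifPn => // _; rewrite lee_fin mulr_ge0.
- by move=> b /= gb; apply: cvgeZl => //; apply: overlap_cvg => /=; rewrite gb.
Qed.

Section CommonLaw.
Hypothesis lX : forall s, uX None s = q None s.
Hypothesis lY : forall s, uY None s = q None s.

Lemma overlap_start n : Phi n None None = 1.
Proof.
rewrite /Phi /overlap /pairing.
have <- := sum_image_weight g sY None n; apply: eq_esum => s _.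
rewrite -image_densityE//; congr EFin; rewrite -/uX -/uY lX lY /=.
have [->|qs] := eqVneq (q None s) 0%R; first by rewrite !mul0r.
by rewrite -mulrA divff ?mulr1.
Qed.

Lemma overlap_lim_start : phi None None = 1%R.
Proof.
rewrite /phi /overlap_lim (_ : (fun n => _) = cst 1) ?lim_cst//.
by apply/funext => n; exact: overlap_start.
Qed.

(** Given the image path c, a second path y above c completes a first path ending
    in oa with total weight that of c: by finite-horizon computation for the
    overlaps, then by domination in the limit. *)
Lemma sum_overlap_lim oa c : end_state None c = omap f oa ->
  \esum_(y in [set y | map g y = c])
     ((path_weight kY None y)%:E * (phi oa (end_state None y))%:E) = (q None c)%:E.
Proof.
move=> ec; have pY0 o y : (0 <= path_weight kY o y)%R by exact: path_weight_ge0.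
have comp y : map g y = c -> omap f oa = omap g (end_state None y).
  by move=> yc; rewrite -ec -yc; exact: (end_state_map g None y).
have [K K0 leK] := overlap_le oa.
apply: (@cvg_unique _ (@ereal_hausdorff R) (fmap (fun n => \esum_(y in [set y | map g y = c])
     ((path_weight kY None y)%:E * Phi n oa (end_state None y))) \oo)).
  apply: (@esum_dominated_cvg_in _ _ _ _ _ (fun y => (K * path_weight kY None y)%:E)).
  - move=> n y /= /comp yc; rewrite mule_ge0 ?overlap_ge0 ?lee_fin//=.
    by rewrite mulrC EFinM lee_wpmul2l ?lee_fin// leK.
  - have := @sum_lifted_paths _ _ _ g kY sY None c [::]; rewrite cats0.
    under eq_esum do rewrite mule1.
    move=> e; under eq_esum do rewrite EFinM.
    rewrite esumZl// ?e => [|y _]; last by rewrite lee_fin.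
    by rewrite -image_densityE// -EFinM ltry.
  - by move=> y /= /comp yc; apply: cvgeZl => //; exact: overlap_cvg.
apply: cvg_near_cst; apply: nearW => n.
under eq_esum => y yc.
  rewrite -esumZl//; last by move=> s _; rewrite lee_fin !mulr_ge0// invr_ge0 q0.
  over.
rewrite esum_swap; last first.
  by move=> y s _ _; rewrite mule_ge0 ?lee_fin// !mulr_ge0// invr_ge0 q0.
transitivity (\esum_(s in [set s | size s = n]) ((q None c)%:E * (uX oa s)%:E)); last first.
  rewrite esumZl//; last by move=> s _; rewrite lee_fin.
  by under eq_esum do rewrite image_densityE//; rewrite sum_image_weight// mule1.
apply: eq_esum => s _.
transitivity (\esum_(y in [set y | map g y = c]) ((uX oa s / q (omap f oa) s)%:E *
    ((path_weight kY None y)%:E * image_weight g kY (end_state None y) s))).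
  apply: eq_esum => y _; rewrite -image_densityE// -!EFinM; congr EFin.
  by rewrite -/uX -/uY -/q; ring.
rewrite esumZl; first last.
- by move=> y _; rewrite mule_ge0 ?lee_fin// image_weight_ge0.
- by rewrite mulr_ge0// invr_ge0 q0.
rewrite sum_lifted_paths// -image_densityE// -/uY lY /q path_weight_cat ec -!EFinM; congr EFin.
have [qs|qs] := eqVneq (path_weight kZ (omap f oa) s) 0%R; last by field.
have [M hu] := image_density_bounded oa sX dX; have [_ /(_ s)/andP[_]] := hu.
rewrite qs mulr0 => us _.
have -> : uX oa s = 0%R by apply/eqP; rewrite eq_le us uX0.
by rewrite !mul0r mulr0.
Qed.

End CommonLaw.
End OverlapTheory.

Lemma overlapC (R : realType) (A B C : countType) (f : A -> C) (g : B -> C)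
    (kX : option A -> A -> R) (kY : option B -> B -> R) (kZ : option C -> C -> R) n oa ob :
  omap f oa = omap g ob -> overlap f g kX kY kZ n oa ob = overlap g f kY kX kZ n ob oa.
Proof. by move=> e; rewrite /overlap -e pairingC. Qed.

Lemma overlap_limC (R : realType) (A B C : countType) (f : A -> C) (g : B -> C)
    (kX : option A -> A -> R) (kY : option B -> B -> R) (kZ : option C -> C -> R) oa ob :
  omap f oa = omap g ob -> overlap_lim f g kX kY kZ oa ob = overlap_lim g f kY kX kZ ob oa.
Proof.
by move=> e; rewrite /overlap_lim; congr (fine (limn _)); apply/funext => n; exact: overlapC.
Qed.

(** * The law of the coupled chain *)

Section Joint.
Context {R : realType} {A B C : countType} {f : A -> C} {g : B -> C}.
Context {kX : option A -> A -> R} {kY : option B -> B -> R} {kZ : option C -> C -> R}.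
Hypotheses (sX : stochastic_kernel kX) (sY : stochastic_kernel kY) (sZ : stochastic_kernel kZ).
Hypotheses (dX : dominated_image kZ f kX) (dY : dominated_image kZ g kY).
Hypothesis lX : forall s, image_density f kX None s = path_weight kZ None s.
Hypothesis lY : forall s, image_density g kY None s = path_weight kZ None s.

Let phi := overlap_lim f g kX kY kZ.

Let kX0 o a : (0 <= kX o a)%R. Proof. by have [] := sX o. Qed.
Let kY0 o a : (0 <= kY o a)%R. Proof. by have [] := sY o. Qed.
Let kZ0 o a : (0 <= kZ o a)%R. Proof. by have [] := sZ o. Qed.
Let pX0 x : (0 <= path_weight kX None x)%R. Proof. exact: path_weight_ge0. Qed.
Let pY0 y : (0 <= path_weight kY None y)%R. Proof. exact: path_weight_ge0. Qed.
Let pZ0 z : (0 <= path_weight kZ None z)%R. Proof. exact: path_weight_ge0. Qed.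
Let phi0 oa ob : (0 <= phi oa ob)%R. Proof. exact: overlap_lim_ge0. Qed.

(** The probability that the coupled chain follows the paths x and y. *)
Definition joint_weight (x : seq A) (y : seq B) : R :=
  (path_weight kX None x * path_weight kY None y / path_weight kZ None (map f x)
    * phi (end_state None x) (end_state None y))%R.

Lemma joint_weight_ge0 x y : (0 <= joint_weight x y)%R.
Proof. by rewrite /joint_weight !mulr_ge0// invr_ge0. Qed.

Lemma end_state_compat x y : map f x = map g y ->
  omap f (end_state None x) = omap g (end_state None y).
Proof. by move=> e; rewrite -[LHS]end_state_map -[RHS]end_state_map e. Qed.

Lemma joint_weight_rcons x y a b : map f x = map g y ->
  joint_weight (rcons x a) (rcons y b) =
  (path_weight kX None x * path_weight kY None y / path_weight kZ None (map f x) *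
   (step_ratio (kX := kX) (kY := kY) (kZ := kZ) (f := f)
      (end_state None x) (end_state None y) a b * phi (Some a) (Some b)))%R.
Proof.
move=> e; rewrite /joint_weight !end_state_rcons map_rcons !path_weight_rcons /step_ratio.
rewrite -[end_state None [seq f i | i <- x]]/(end_state (omap f None) (map f x)) end_state_map.
by rewrite invfM; ring.
Qed.

(** One step of the coupled chain cannot increase the weight, because phi is
    harmonic. In particular a path of positive weight keeps to the support of
    phi. *)
Lemma joint_weight_rcons_le x y a b : map f (rcons x a) = map g (rcons y b) ->
  (joint_weight (rcons x a) (rcons y b) <= joint_weight x y)%R.
Proof.
rewrite !map_rcons => /rcons_inj[e fa]; rewrite joint_weight_rcons// /joint_weight.
rewrite ler_wpM2l ?mulr_ge0 ?invr_ge0// -lee_fin.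
rewrite -(overlap_lim_step sX sY sZ dX dY (end_state_compat e)) EFinM.
pose F a b : \bar R := (step_ratio (kX := kX) (kY := kY) (kZ := kZ) (f := f)
  (end_state None x) (end_state None y) a b)%:E * (phi (Some a) (Some b))%:E.
have F0 a' b' : 0 <= F a' b' by rewrite mule_ge0 ?lee_fin// !mulr_ge0// invr_ge0.
apply: (@le_trans _ _ (\esum_(b in [set b | g b = f a]) F a b)).
  exact: (@le_esum_term _ _ _ (F a)).
apply: (@le_esum_term _ _ _ (fun a => \esum_(b in [set b | g b = f a]) F a b)) => // a' _.
exact: esum_ge0.
Qed.

Lemma path_weight_le_image x : (path_weight kX None x <= path_weight kZ None (map f x))%R.
Proof.
rewrite -lX -lee_fin image_densityE// -[map f x]cats0 -sum_lifted_paths//.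
under eq_esum do rewrite mule1.
by apply: le_esum_term => // t _; rewrite lee_fin.
Qed.

(** A path x whose image has weight zero has weight zero itself, which settles the
    case of a vanishing denominator. *)
Lemma sum_joint_weight x :
  \esum_(y in [set y | map g y = map f x]) (joint_weight x y)%:E = (path_weight kX None x)%:E.
Proof.
transitivity (\esum_(y in [set y | map g y = map f x])
   ((path_weight kX None x / path_weight kZ None (map f x))%:E *
    ((path_weight kY None y)%:E * (phi (end_state None x) (end_state None y))%:E))).
  by apply: eq_esum => y _; rewrite -!EFinM; congr EFin; rewrite /joint_weight; ring.
rewrite esumZl ?divr_ge0//; last by move=> y _; rewrite mule_ge0 ?lee_fin.
rewrite (sum_overlap_lim sX sY sZ dX dY lY); last exact: (end_state_map f None x).
rewrite -EFinM; congr EFin.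
have [z0|z0] := eqVneq (path_weight kZ None (map f x)) 0%R; last by rewrite divfK.
have := path_weight_le_image x; rewrite z0 mulr0 => x0.
by apply/esym/eqP; rewrite eq_le x0 pX0.
Qed.

End Joint.

Section CoupledChain.
Context {R : realType} {A B C : countType} (f : A -> C) (g : B -> C).
Context (alphaX : A -> R) (PX : A -> A -> R) (alphaY : B -> R) (PY : B -> B -> R).
Context (alphaZ : C -> R) (PZ : C -> C -> R).
Let kX := start_kernel alphaX PX.
Let kY := start_kernel alphaY PY.
Let kZ := start_kernel alphaZ PZ.
Hypotheses (sX : stochastic_kernel kX) (sY : stochastic_kernel kY) (sZ : stochastic_kernel kZ).
Hypotheses (dX : dominated_image kZ f kX) (dY : dominated_image kZ g kY).
Hypothesis lX : forall s, image_density f kX None s = path_weight kZ None s.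
Hypothesis lY : forall s, image_density g kY None s = path_weight kZ None s.

Definition harmonic (x : Delta f g) : R :=
  overlap_lim f g kX kY kZ (Some (val x).1) (Some (val x).2).

Let alphaW := alphaD' alphaX alphaY alphaZ (phi := harmonic).
Let PW := PD' PX PY PZ (phi := harmonic).
Let J := joint_weight (f := f) (g := g) (kX := kX) (kY := kY) (kZ := kZ).

Let kZ0 o a : (0 <= kZ o a)%R. Proof. by have [] := sZ o. Qed.

Lemma RmxE (x y : Delta f g) : Rmx PX PY PZ x y =
  (PX (val x).1 (val y).1 * PY (val x).2 (val y).2 / PZ (f (val x).1) (f (val y).1))%R.
Proof.
rewrite /Rmx; case: (val x) => a b; case: (val y) => a' b' /=.
case: ltP => // h; have -> : PZ (f a) (f a') = 0%R.
  by apply/eqP; rewrite eq_le h (kZ0 (Some (f a)) (f a')).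
by rewrite invr0 mulr0.
Qed.

Lemma alphaD'E (x : Delta' harmonic) : alphaW x =
  (alphaX (fstD' x) * alphaY (sndD' x) / alphaZ (f (fstD' x)) * harmonic (val x))%R.
Proof.
rewrite /alphaW /alphaD' /fstD' /sndD'; case: (val (val x)) => a b /=.
case: ltP => // h; have -> : alphaZ (f a) = 0%R.
  by apply/eqP; rewrite eq_le h (kZ0 None (f a)).
by rewrite invr0 mulr0 mul0r.
Qed.

Lemma fst_sndD' (x : Delta' harmonic) : f (fstD' x) = g (sndD' x).
Proof. exact/eqP/(valP (val x)). Qed.

Lemma fst_sndD'_inj (x y : Delta' harmonic) : fstD' x = fstD' y -> sndD' x = sndD' y -> x = y.
Proof.
move=> e1 e2; apply/val_inj/val_inj; move: e1 e2; rewrite /fstD' /sndD'.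
by case: (val (val x)) => ? ?; case: (val (val y)) => ? ? /= -> ->.
Qed.

Lemma map_fst_sndD' (w : seq (Delta' harmonic)) :
  map f (map (@fstD' _ _ _ _ _ _ _) w) = map g (map (@sndD' _ _ _ _ _ _ _) w).
Proof. by rewrite -!map_comp; apply: eq_map => x; exact: fst_sndD'. Qed.

(** The factors phi introduced by the h-transform cancel, except for the last. *)
Lemma coupled_path_weight (w : seq (Delta' harmonic)) :
  path_weight (start_kernel alphaW PW) None w =
  J (map (@fstD' _ _ _ _ _ _ _) w) (map (@sndD' _ _ _ _ _ _ _) w).
Proof.
elim/last_ind: w => [|w z IH].
  by rewrite /J /joint_weight /= !mul1r invr1 (overlap_lim_start sY lX lY) mul1r.
rewrite path_weight_rcons IH !map_rcons /J joint_weight_rcons; last exact: map_fst_sndD'.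
rewrite /joint_weight -!mulrA; congr (_ * (_ * (_ * _)))%R.
case/lastP: w {IH} => [|w x]; rewrite ?map_rcons ?end_state_rcons.
  by rewrite /= (overlap_lim_start sY lX lY) mul1r alphaD'E /step_ratio -!mulrA.
have hx : harmonic (val x) != 0%R by rewrite gt_eqF// (valP x).
rewrite /= /PW /PD' RmxE -[overlap_lim _ _ _ _ _ (Some (fstD' x)) _]/(harmonic (val x)).
rewrite -[overlap_lim _ _ _ _ _ (Some (fstD' z)) _]/(harmonic (val z)) /fstD' /sndD'.
by rewrite -[(_ * _ * harmonic (val z))%R in LHS]mulrA mulrA divff// mul1r !mulrA.
Qed.

Context d (Om : measurableType d) (Pr : probability Om R) (W : nat -> Om -> Delta' harmonic).
Hypothesis hW : has_path_law Pr (start_kernel alphaW PW) W.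

Let X t w := fstD' (W t w).
Let Y t w := sndD' (W t w).

(** Either x and y zip to a path in the support of phi, and
    [coupled_path_weight] applies; or the event is empty, and the weight vanishes
    because a path of positive weight has all its states in the support. *)
Lemma joint_path_law x y : size x = size y ->
  Pr (prefix_event X x `&` prefix_event Y y) =
  (if map f x == map g y then J x y else 0%R)%:E.
Proof.
move=> sxy; have [pW lW] := hW.
have [[w [wx wy]]|nw] := pselect (exists w, map (@fstD' _ _ _ _ _ _ harmonic) w = x
    /\ map (@sndD' _ _ _ _ _ _ harmonic) w = y).
  have -> : prefix_event X x `&` prefix_event Y y = prefix_event W w.
    apply/seteqP; split=> o; rewrite /prefix_event/=.
      rewrite -wx -wy !size_map => -[ex ey].
      have lif (T : eqType) (h : Delta' harmonic -> T) s1 s2 i z : (i < size s1)%N -> size s1 = size s2 ->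
          map h s1 = map h s2 -> h (nth z s1 i) = h (nth z s2 i).
        by move=> i1 s12 e12; rewrite -!(nth_map z (h z))// -?s12// e12.
      have sW : size (mkseq (trajectory W o) (size w)) = size w by rewrite size_mkseq.
      apply: (@eq_from_nth _ (W 0%N o)) => // i; rewrite sW => iw.
      apply: fst_sndD'_inj.
        by apply: lif; rewrite ?sW// -ex /mkseq -map_comp.
      by apply: lif; rewrite ?sW// -ey /mkseq -map_comp.
    by move=> ew; rewrite -wx -wy !size_map; split; rewrite -[in RHS]ew /mkseq -map_comp.
  by rewrite lW coupled_path_weight wx wy -wx -wy map_fst_sndD' eqxx.
have -> : prefix_event X x `&` prefix_event Y y = set0.
  apply/seteqP; split=> // o [ex ey]; apply: nw.
  exists (mkseq (trajectory W o) (size x)).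
  by split; [rewrite -[RHS]ex|rewrite sxy -[RHS]ey]; rewrite /mkseq -map_comp.
rewrite measure0; case: eqP => // e; congr EFin; apply/esym/eqP; rewrite -[_ == _]negbK.
apply/negP => J0; apply: nw; move: J0 sxy e.
elim/last_ind: x y => [|x a IH] y; case/lastP: y => [|y b]; rewrite ?size_rcons//.
  by exists [::].
move=> J0 [sxy] e.
have Jxy : J x y != 0%R.
  apply: contra J0 => /eqP J0; rewrite eq_le joint_weight_ge0// andbT -J0.
  exact: (joint_weight_rcons_le sX sY sZ dX dY e).
have := e; rewrite !map_rcons => /rcons_inj[exy eab].
have [w [<- <-]] := IH y Jxy sxy exy.
have abD : f (a, b).1 == g (a, b).2 by rewrite eab.
pose x0 : Delta f g := Sub (a, b) abD.
have h0 : (0 < harmonic x0)%R.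
  rewrite lt0r overlap_lim_ge0// andbT; apply: contra J0 => /eqP.
  rewrite /harmonic SubK /= => h0.
  by rewrite /J /joint_weight !end_state_rcons h0 mulr0.
pose z : Delta' harmonic := Sub x0 h0.
by exists (rcons w z); rewrite !map_rcons /fstD' /sndD' !SubK.
Qed.

Let pX : is_process X. Proof. by have [pW _] := hW; exact: process_map. Qed.
Let pY : is_process Y. Proof. by have [pW _] := hW; exact: process_map. Qed.

Lemma fst_path_law : has_path_law Pr kX X.
Proof.
split=> // x; rewrite -(sum_joint_weight sX sY sZ dX dY lX lY).
rewrite -[prefix_event X x]setTI (_ : setT = trajectory Y @^-1` horizon (size x) setT)//.
rewrite additive_horizon//; [|exact: measure_additive|exact: prefix_event_measurable].
rewrite esum_mkcond [RHS]esum_mkcond; apply: eq_esum => y _.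
case: ifPn; [rewrite inE => -[sy _]|rewrite notin_setE /= => ny].
  rewrite setIC [LHS](joint_path_law (esym sy)); have [e|ne] := eqVneq (map f x) (map g y).
    by rewrite ifT// inE.
  by rewrite ifF//; apply/negbTE; rewrite notin_setE => /= e; rewrite e eqxx in ne.
rewrite ifF//; apply/negbTE; rewrite notin_setE => /= /(congr1 size).
by rewrite !size_map => sy; apply: ny.
Qed.

(** The roles of the two chains are exchanged; the overlap is symmetric on pairs
    with the same image. *)
Lemma snd_path_law : has_path_law Pr kY Y.
Proof.
split=> // y; rewrite -(sum_joint_weight sY sX sZ dY dX lY lX).
rewrite -[prefix_event Y y]setTI (_ : setT = trajectory X @^-1` horizon (size y) setT)//.
rewrite additive_horizon//; [|exact: measure_additive|exact: prefix_event_measurable].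
rewrite esum_mkcond [RHS]esum_mkcond; apply: eq_esum => x _.
case: ifPn; [rewrite inE => -[sx _]|rewrite notin_setE /= => nx].
  rewrite [LHS](joint_path_law sx); have [e|ne] := eqVneq (map f x) (map g y).
    rewrite ifT ?inE// /J /joint_weight e (overlap_limC _ _ _ (end_state_compat e)).
    by rewrite [(path_weight kX _ _ * _)%R]mulrC.
  by rewrite ifF//; apply/negbTE; rewrite notin_setE => /= e; rewrite e eqxx in ne.
rewrite ifF//; apply/negbTE; rewrite notin_setE => /= /(congr1 size).
by rewrite !size_map => sx; apply: nx.
Qed.

End CoupledChain.

(** * Conditional probabilities given a sub-sigma-algebra *)

Section SubSigma.
Context {R : realType} {d} {Om : measurableType d} (Pr : probability Om R).
Context (G : set_system Om).
Hypotheses (sG : sigma_algebra [set: Om] G) (subG : G `<=` measurable).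

Definition sub_measurable (h : Om -> R) := forall B : set R, measurable B -> G (h @^-1` B).

Local Notation OmG := (g_sigma_algebraType G).

Lemma measurable_subE : (@measurable _ OmG) = G.
Proof. exact: sigma_algebra_id. Qed.

Lemma sub_measurableP (h : Om -> R) :
  sub_measurable h <-> measurable_fun [set: OmG] (h : OmG -> R).
Proof.
split=> mh; first by move=> _ B mB; rewrite setTI measurable_subE; exact: mh.
by move=> B mB; have := mh measurableT _ mB; rewrite setTI measurable_subE.
Qed.

Lemma sub_measurable_fun (h : Om -> R) : sub_measurable h -> measurable_fun [set: Om] h.
Proof. by move=> mh _ B mB; rewrite setTI; exact/subG/mh. Qed.

Section Trace.
Context (E : set Om) (mE : measurable E).

(** Restricting to G the measure carried by E turns it into a measure on a type
    whose measurable sets are those of G, where densities are G-measurable. *)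
Definition trace_measure (D : set OmG) : \bar R := Pr (D `&` E).

Let trace0 : trace_measure set0 = 0. Proof. by rewrite /trace_measure set0I measure0. Qed.

Let trace_ge0 D : 0 <= trace_measure D. Proof. exact: (measure_ge0 Pr). Qed.

Let trace_sigma_additive : semi_sigma_additive trace_measure.
Proof.
move=> F mF tF mU; rewrite measurable_subE in mU.
apply: (@measure_semi_sigma_additive _ _ _ (mrestr Pr mE) F) => //; last exact: subG.
by move=> i; apply: subG; rewrite -measurable_subE; exact: mF.
Qed.

HB.instance Definition _ := isMeasure.Build _ _ _ trace_measure
  trace0 trace_ge0 trace_sigma_additive.

Let trace_fin : fin_num_fun trace_measure.
Proof.
move=> D; rewrite measurable_subE => /subG mD; rewrite fin_num_measure//; exact: measurableI.
Qed.

HB.instance Definition _ := Measure_isFinite.Build _ _ _ trace_measure trace_fin.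

Definition finite_trace : {finite_measure set OmG -> \bar R} := trace_measure.

End Trace.

Lemma integral_trace (D : set Om) (h : Om -> \bar R) : G D ->
  measurable_fun [set: OmG] (h : OmG -> \bar R) -> (forall w, 0 <= h w) ->
  \int[finite_trace measurableT]_(w in (D : set OmG)) h w = \int[Pr]_(w in D) h w.
Proof.
move=> GD mh h0; pose i : Om -> OmG := id.
have mi : measurable_fun [set: Om] i.
  by move=> _ B; rewrite measurable_subE setTI => /subG.
have GD' : measurable (D : set OmG) by rewrite measurable_subE.
rewrite -[RHS]/(\int[Pr]_(w in i @^-1` D) (h \o i) w) -(ge0_integral_pushforward mi)//; last first.
  by apply: measurable_funS mh.
pose i' : {mfun Om >-> OmG} := HB.pack i (isMeasurableFun.Build _ _ _ _ i mi).
apply: (eq_measure_integral (pushforward Pr i')) => A mA _.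
by rewrite /= /pushforward /trace_measure setIT.
Qed.

(** Versions of the conditional probability of E. They are bounded by 2 rather than
    1 because a single inequality shows that a density is below 2 almost surely. *)
Definition bounded_version (E : set Om) (u : Om -> R) :=
  [/\ sub_measurable u, forall w, (0 <= u w <= 2)%R &
      forall D, G D -> \int[Pr]_(w in D) (u w)%:E = Pr (E `&` D)].

(** The density of the trace of E with respect to the trace of the whole space,
    truncated on the set B where it is at least 2. This set is null, since
    2 mu(B) <= nu(B) <= mu(B). *)
Lemma bounded_version_exists E : measurable E -> exists u, bounded_version E u.
Proof.
move=> mE; pose mu := finite_trace measurableT; pose nu := finite_trace mE.
have GC D : G D -> G (~` D) by case: sG => _ /(_ D) + _ GD; rewrite setTD; exact.
have muE D : mu D = Pr D by rewrite /mu/= /trace_measure setIT.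
have nuE D : nu D = Pr (E `&` D) by rewrite /nu/= /trace_measure setIC.
have numu D : G D -> nu D <= mu D.
  move=> GD; rewrite muE nuE; apply: le_measure; rewrite ?inE//; last exact: subG.
  by apply: measurableI => //; exact: subG.
have dom : nu `<< mu.
  apply/null_content_dominatesP => D; rewrite measurable_subE => GD mu0.
  by apply/eqP; rewrite eq_le measure_ge0 andbT -mu0 numu.
have [f [f0 /integrableP[mf _] fE]] := radon_nikodym_finite dom.
pose B := [set w : OmG | 2%:E <= f w].
have mB : measurable B by rewrite -[B]setTI; exact: emeasurable_fun_c_infty.
have GB : G B by rewrite -measurable_subE.
have nuB : mu B = 0.
  have : 2%:E * mu B <= mu B.
    apply: le_trans (numu _ GB); rewrite fE// -integral_cst//.
    by apply: ge0_le_integral => // [w _|]; [rewrite lee_fin|exact: measurable_funTS].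
  have fin : mu B \is a fin_num by rewrite fin_num_measure.
  rewrite -(fineK fin) -EFinM lee_fin => le.
  congr EFin; apply/eqP; rewrite eq_le fine_ge0// andbT; lra.
pose u w := if w \in B then 0%R else fine (f w).
have uE w : (u w)%:E = f w * (\1_(~` B) w)%:E.
  rewrite /u indicE in_setC; case: ifPn => wB /=; first by rewrite mule0.
  rewrite mule1 fineK// ge0_fin_numE//; apply: (@lt_trans _ _ 2%:E); rewrite ?ltry//.
  by rewrite ltNge; apply: contra wB => fw; rewrite inE.
have u0 w : (0 <= u w)%R by rewrite /u; case: ifP => // _; rewrite fine_ge0.
have mu_u : measurable_fun [set: OmG] (EFin \o u : OmG -> \bar R).
  rewrite (_ : _ \o _ = (fun w => f w * (\1_(~` B) w)%:E)); last by apply/funext => w; exact: uE.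
  apply: emeasurable_funM => //; apply/measurable_EFinP/measurable_indic.
  exact: measurableC.
exists u; split.
- by apply/sub_measurableP; exact/measurable_EFinP.
- move=> w; rewrite u0/= /u; case: ifPn => // wB; rewrite -lee_fin fineK.
    by rewrite leNgt; apply: contra wB => fw; rewrite inE; exact: ltW.
  rewrite ge0_fin_numE//; apply: (@lt_trans _ _ 2%:E); rewrite ?ltry//.
  by rewrite ltNge; apply: contra wB => fw; rewrite inE.
- move=> D GD.
  have mD : measurable (D : set OmG) by rewrite measurable_subE.
  rewrite -integral_trace//.
  transitivity (\int[mu]_(w in D `&` ~` B) f w).
    rewrite [RHS]integral_mkcondr; apply: eq_integral => w _.
    by rewrite uE patchE indicE; case: ifPn; rewrite ?mule1// mule0.
  rewrite -fE; last by apply: measurableI => //; exact: measurableC.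
  have DE : D = (D `&` B) `|` (D `&` ~` B) by rewrite -setIUr setUv setIT.
  rewrite -[RHS]nuE [in RHS]DE measureU//.
  + rewrite [X in _ = X + _](_ : _ = 0) ?add0e//.
    apply/eqP; rewrite eq_le measure_ge0 andbT -nuB.
    apply: (@le_trans _ _ (nu B)); last exact: numu.
    by apply: le_measure; rewrite ?inE//; exact: measurableI.
  + exact: measurableI.
  + by apply: measurableI => //; exact: measurableC.
  + by rewrite setIACA setICr setI0.
Qed.

(** The sum is the integral part of y. *)
Let unit_count (n : nat) (y : R) : (0 <= y <= n%:R)%R ->
  (y - 1 <= \sum_(i < n) ((i.+1%:R <= y)%R : nat)%:R <= y)%R.
Proof.
elim: n y => [|n IH] y /andP[y0 yn].
  by rewrite big_ord0 y0 andbT subr_le0 (le_trans yn).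
rewrite big_ord_recl /=; have [y1|y1] := leP 1%R y.
  have /IH : (0 <= y - 1 <= n%:R)%R by rewrite subr_ge0 y1/= lerBlDr natr1.
  set s := (\sum_(i < n) _)%R; set s' := (\sum_(i < n) _)%R.
  have -> : s' = s.
    by apply: eq_bigr => i _; rewrite /bump/= add1n -[i.+2%:R]natr1 lerBrDr.
  by rewrite mulr1n => /andP[h1 h2]; apply/andP; split; lra.
rewrite mulr0n add0r big1; first by apply/andP; split; lra.
move=> i _; rewrite /bump/= add1n; case: leP => // h; exfalso.
have : (1 <= i.+2%:R :> R)%R by rewrite ler1n.
by move=> /le_trans /(_ h); rewrite leNgt y1.
Qed.

Definition bounded_fun (w : Om -> R) :=
  measurable_fun [set: Om] w /\ forall x, (0 <= w x <= 2)%R.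

Lemma bounded_integral_fin w D : measurable D -> bounded_fun w ->
  \int[Pr]_(x in D) (w x)%:E \is a fin_num.
Proof.
move=> mD [mw w2]; rewrite ge0_fin_numE; last first.
  by apply: integral_ge0 => x _; rewrite lee_fin; have /andP[] := w2 x.
apply: (@le_lt_trans _ _ (\int[Pr]_(x in D) (cst 2%:E x))).
  apply: ge0_le_integral => //.
  - by move=> x _; rewrite lee_fin; have /andP[] := w2 x.
  - by apply/measurable_EFinP; exact: measurable_funTS.
  - by move=> x _; rewrite lee_fin; have /andP[] := w2 x.
rewrite integral_cst// lte_mul_pinfty//.
by rewrite ltey_eq fin_num_measure.
Qed.

Lemma bounded_version_fun E u : bounded_version E u -> bounded_fun u.
Proof. by move=> [mu u2 _]; split => //; exact: sub_measurable_fun. Qed.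

Section LayerCake.
Variables (N : nat) (h : Om -> R).
Hypotheses (N0 : (0 < N)%N) (mh : sub_measurable h) (h2 : forall x, (0 <= h x <= 2)%R).

Let layer i : set Om := [set x | (i.+1%:R <= N%:R * h x)%R].

Let layerG i : G (layer i).
Proof.
rewrite (_ : layer i = h @^-1` `[(i.+1%:R / N%:R)%R, +oo[%classic); first exact: mh.
apply/seteqP; split=> x; rewrite /layer/= in_itv/= andbT ler_pdivrMr ?ltr0n// mulrC//.
Qed.

(** The integral of w times h, with h rounded down to a multiple of 1 / N. The number
    of layers is 2 N because h is bounded by 2. *)
Definition layer_sum (w : Om -> R) : \bar R :=
  \sum_(i < (2 * N)%N) ((N%:R^-1)%:E * \int[Pr]_(x in layer i) (w x)%:E).

Lemma layer_sum_le w : bounded_fun w ->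
  layer_sum w <= \int[Pr]_x (w x * h x)%:E <= layer_sum w + (2 / N%:R)%:E.
Proof.
move=> [mw w2]; have NR : (0 < N%:R :> R)%R by rewrite ltr0n.
have w0 x : (0 <= w x)%R by have /andP[] := w2 x.
pose hN x : R := (N%:R^-1 * \sum_(i < (2 * N)%N) ((i.+1%:R <= N%:R * h x)%R : nat)%:R)%R.
have mlayer i : measurable (layer i) by exact: subG.
have hNE x : hN x = (\sum_(i < (2 * N)%N) N%:R^-1 * \1_(layer i) x)%R.
  rewrite /hN mulr_sumr; apply: eq_bigr => i _; congr (_ * _)%R.
  by rewrite indicE; congr (nat_of_bool _)%:R; apply/idP/idP; rewrite inE.
have bnd x : (hN x <= h x <= hN x + N%:R^-1)%R.
  have := @unit_count (2 * N)%N (N%:R * h x)%R; have /andP[hx0 hx2] := h2 x.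
  rewrite mulr_ge0//= natrM [X in (_ <= X)%R -> _]mulrC ler_wpM2l// => /(_ isT) /andP[c1 c2].
  rewrite /hN; set c := (\sum_(i < _) _)%R in c1 c2 *.
  have hE : h x = (N%:R^-1 * (N%:R * h x))%R by rewrite mulKf// gt_eqF.
  have -> : (N%:R^-1 * c + N%:R^-1 = N%:R^-1 * (c + 1))%R by rewrite mulrDr mulr1.
  by rewrite hE; apply/andP; split; rewrite ler_wpM2l ?invr_ge0 ?ler0n//; lra.
have hN0 x : (0 <= hN x)%R by rewrite mulr_ge0 ?invr_ge0// sumr_ge0.
have mhN : measurable_fun [set: Om] hN.
  rewrite (funext hNE); apply: measurable_sum => i.
  by apply: measurable_funM => //; exact: measurable_indic.
have -> : layer_sum w = \int[Pr]_x (w x * hN x)%:E.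
  under eq_integral => x _ do rewrite hNE mulr_sumr -sumEFin.
  rewrite ge0_integral_sum//; last 2 first.
  - move=> i; apply/measurable_EFinP; apply: measurable_funM => //.
    by apply: measurable_funM => //; exact: measurable_indic.
  - by move=> i x _; rewrite lee_fin !mulr_ge0// invr_ge0.
  apply: eq_bigr => i _.
  rewrite [in LHS]integral_mkcond -ge0_integralZl//.
  - apply: eq_integral => x _; rewrite patchE indicE.
    by case: ifPn => _ /=; rewrite ?mulr1 ?mulr0 ?mule0// mulrC -EFinM.
  - apply: (measurable_restrictT _ _).1 => //; apply/measurable_EFinP.
    exact: measurable_funTS.
  - by move=> x _; rewrite patchE; case: ifPn => //; rewrite lee_fin.
have mwh : measurable_fun [set: Om] (fun x => (w x * h x)%:E).
  by apply/measurable_EFinP; apply: measurable_funM => //; exact: sub_measurable_fun.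
have mwhN : measurable_fun [set: Om] (fun x => (w x * hN x)%:E).
  by apply/measurable_EFinP; apply: measurable_funM.
apply/andP; split.
  apply: ge0_le_integral => // x _; rewrite lee_fin; first by rewrite mulr_ge0.
  by rewrite ler_wpM2l//; have /andP[] := bnd x.
have -> : (2 / N%:R)%:E = \int[Pr]_(x in [set: Om]) (cst (2 / N%:R)%:E x).
  by rewrite integral_cst// [X in _ * X]probability_setT mule1.
rewrite -ge0_integralD//; last 2 first.
- by move=> x _; rewrite lee_fin mulr_ge0.
- by move=> x _; rewrite lee_fin divr_ge0.
apply: ge0_le_integral => //.
- by move=> x _; rewrite lee_fin mulr_ge0//; have /andP[] := h2 x.
- by apply: emeasurable_funD.
move=> x _; rewrite -EFinD lee_fin; have /andP[_ b2] := bnd x; have /andP[_ wx2] := w2 x.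
apply: (@le_trans _ _ (w x * (hN x + N%:R^-1))%R); first by rewrite ler_wpM2l.
by rewrite mulrDr lerD2l ler_wpM2r// invr_ge0.
Qed.

Lemma layer_sum_fin w : bounded_fun w -> layer_sum w \is a fin_num.
Proof.
move=> bw; apply/sum_fin_numP => i _ _; rewrite fin_numM// bounded_integral_fin//.
exact: subG.
Qed.

Lemma layer_sum_cvg (w : nat -> Om -> R) w' :
  (forall k, bounded_fun (w k)) -> bounded_fun w' ->
  (forall D, G D -> \int[Pr]_(x in D) (w k x)%:E @[k --> \oo] --> \int[Pr]_(x in D) (w' x)%:E) ->
  layer_sum (w k) @[k --> \oo] --> layer_sum w'.
Proof.
move=> bw bw' cw; apply: cvg_nnesum => i _.
  apply: nearW => k; rewrite mule_ge0 ?lee_fin ?invr_ge0//.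
  by apply: integral_ge0 => x _; rewrite lee_fin; have [_ /(_ x)/andP[]] := bw k.
by apply: cvgeZl => //; exact: cw.
Qed.

End LayerCake.

(** Weak convergence against indicators of G extends to all bounded G-measurable
    test functions h, by cutting h into finitely many layers of height 1 / N. *)
Lemma weak_test (w : nat -> Om -> R) (w' h : Om -> R) :
  (forall k, bounded_fun (w k)) -> bounded_fun w' ->
  sub_measurable h -> (forall x, (0 <= h x <= 2)%R) ->
  (forall D, G D -> \int[Pr]_(x in D) (w k x)%:E @[k --> \oo] --> \int[Pr]_(x in D) (w' x)%:E) ->
  \int[Pr]_x (w k x * h x)%:E @[k --> \oo] --> \int[Pr]_x (w' x * h x)%:E.
Proof.
move=> bw bw' mh h2 cw.
have fin v : bounded_fun v -> \int[Pr]_x (v x * h x)%:E \is a fin_num.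
  move=> bv; have [_ v2] := bv; have /andP[_ le] := layer_sum_le (ltn0Sn 0) mh h2 bv.
  rewrite ge0_fin_numE; last first.
    apply: integral_ge0 => x _; rewrite lee_fin mulr_ge0//; first by have /andP[] := v2 x.
    by have /andP[] := h2 x.
  by apply: (le_lt_trans le); rewrite ltey_eq fin_numD layer_sum_fin.
rewrite -(fineK (fin _ bw')); apply/fine_cvgP; split; first by apply: nearW => k; exact: fin.
apply/cvgrPdist_le => e e0.
(* Both roundings of h cost at most 2 / N. *)
have [N N0 Ne] : exists2 N, (0 < N)%N & (2 / N%:R <= e / 2)%R.
  have [N /andP[N0 NE]] : exists N, (0 < N)%N && (4 / e <= N%:R)%R.
    exists (Num.Def.truncn (4 / e)).+1; rewrite ltn0Sn/=.
    exact/ltW/truncnS_gt.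
  exists N => //; rewrite ler_pdivrMr ?ltr0n// mulrAC ler_pdivlMr//.
  by move: NE; rewrite ler_pdivrMr// => NE; lra.
have cL := layer_sum_cvg N0 mh bw bw' cw.
have fL v : bounded_fun v -> layer_sum N h v \is a fin_num by move=> bv; apply: layer_sum_fin.
rewrite -(fineK (fL _ bw')) in cL.
have e20 : (0 < e / 2)%R by rewrite divr_gt0.
have /cvgrPdist_le/(_ _ e20) near1 : fine (layer_sum N h (w k)) @[k --> \oo] --> fine (layer_sum N h w').
  exact: fine_cvg cL.
near=> k.
have d1 : (`|fine (layer_sum N h w') - fine (layer_sum N h (w k))| <= e / 2)%R.
  by near: k; exact: near1.
have := layer_sum_le N0 mh h2 bw'; have := layer_sum_le N0 mh h2 (bw k).
rewrite -(fineK (fL _ bw')) -(fineK (fL _ (bw k))) -(fineK (fin _ bw')) -(fineK (fin _ (bw k))).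
rewrite -!EFinD !lee_fin /= => /andP[a1 a2] /andP[b1 b2].
move: d1; rewrite !ler_norml => /andP[d1 d2]; apply/andP; split; lra.
Unshelve. all: by end_near.
Qed.

Lemma equal_test (w w' h : Om -> R) : bounded_fun w -> bounded_fun w' ->
  sub_measurable h -> (forall x, (0 <= h x <= 2)%R) ->
  (forall D, G D -> \int[Pr]_(x in D) (w x)%:E = \int[Pr]_(x in D) (w' x)%:E) ->
  \int[Pr]_x (w x * h x)%:E = \int[Pr]_x (w' x * h x)%:E.
Proof.
move=> bw bw' mh h2 e.
have := @weak_test (fun=> w) w' h (fun=> bw) bw' mh h2 => /(_ _)/cvg_lim <- //; last first.
  by move=> D GD; rewrite e//; exact: cvg_cst.
by rewrite lim_cst.
Qed.

Lemma integral_indic_mul (D : set Om) (h : Om -> R) : measurable D ->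
  \int[Pr]_x (\1_D x * h x)%:E = \int[Pr]_(x in D) (h x)%:E.
Proof.
move=> mD; rewrite [RHS]integral_mkcond; apply: eq_integral => x _.
by rewrite patchE indicE; case: ifPn => _ /=; rewrite ?mul1r ?mul0r.
Qed.

Lemma indic_bounded_fun (D : set Om) : measurable D -> bounded_fun \1_D.
Proof.
move=> mD; split; first exact: measurable_indic.
by move=> x; rewrite indicE; case: (_ \in _); rewrite /= ?lexx ?ler0n ?ler1n.
Qed.

(** A conditional probability may replace the event inside an expectation
    against a G-measurable weight. *)
Lemma version_pull E u h : measurable E -> bounded_version E u ->
  sub_measurable h -> (forall x, (0 <= h x <= 2)%R) ->
  \int[Pr]_x (u x * h x)%:E = \int[Pr]_(x in E) (h x)%:E.
Proof.
move=> mE bu mh h2; have [_ _ uE] := bu.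
rewrite -integral_indic_mul//; apply: equal_test => //; first exact: bounded_version_fun bu.
  exact: indic_bounded_fun.
move=> D GD; have mD := subG GD; rewrite uE//.
by rewrite integral_indic.
Qed.

End SubSigma.

(** * Conditional independence from finite-dimensional laws *)

Section SigmaProcess.
Context {R : realType} {d} {Om : measurableType d} (Pr : probability Om R).
Context {C : countType} (V : nat -> Om -> C).
Hypothesis pV : is_process V.

Local Notation G := (sigma_process V).

Lemma sigma_process_algebra : sigma_algebra [set: Om] G.
Proof. exact/sigma_algebra_preimage/path_sigma_algebra. Qed.

Lemma sigma_process_sub : G `<=` measurable.
Proof. by move=> _ [E mE <-]; rewrite setTI; exact: process_measurable. Qed.

Lemma sigma_processP (E : set (nat -> C)) : path_measurable E -> G (trajectory V @^-1` E).
Proof. by move=> mE; exists E => //; rewrite setTI. Qed.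

Let sG := sigma_process_algebra.
Let subG := sigma_process_sub.

(** The conditional probability of D given the first k letters of V, equal to 0
    where these have probability zero. *)
Definition elementary_version (D : set Om) k (w : Om) : R :=
  let s := mkseq (trajectory V w) k in
  (fine (Pr (D `&` prefix_event V s)) / fine (Pr (prefix_event V s)))%R.

Section Elementary.
Context (F : set Om) (mF : measurable F).

Let ratio (s : seq C) : R :=
  (fine (Pr (F `&` prefix_event V s)) / fine (Pr (prefix_event V s)))%R.

Let mprefix s : measurable (prefix_event V s).
Proof. exact: prefix_event_measurable. Qed.

Let fin D : measurable D -> Pr D \is a fin_num.
Proof. by move=> mD; rewrite fin_num_measure. Qed.

Let ratio_mul s : (ratio s)%:E * Pr (prefix_event V s) = Pr (F `&` prefix_event V s).
Proof.
have mFs : measurable (F `&` prefix_event V s) by exact: measurableI.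
have [p0|p0] := eqVneq (fine (Pr (prefix_event V s))) 0%R; last first.
  by rewrite -[X in _ * X](fineK (fin (mprefix s))) -EFinM /ratio divfK// fineK// fin.
have p0' : Pr (prefix_event V s) = 0 by rewrite -(fineK (fin (mprefix s))) p0.
rewrite p0' mule0; apply/esym/eqP; rewrite eq_le measure_ge0 andbT -p0'.
by apply: le_measure; rewrite ?inE//; exact: subIsetr.
Qed.

Let ratio01 s : (0 <= ratio s <= 1)%R.
Proof.
have mFs : measurable (F `&` prefix_event V s) by exact: measurableI.
rewrite /ratio divr_ge0 ?fine_ge0//=; have := measure_ge0 Pr (prefix_event V s).
rewrite le_eqVlt => /orP[/eqP <-|p0]; first by rewrite /= invr0 mulr0.
rewrite ler_pdivrMr; last by rewrite fine_gt0// p0 ltey_eq fin.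
rewrite mul1r fine_le ?fin//; apply: le_measure; rewrite ?inE//; exact: subIsetr.
Qed.

Let additiveF : countably_additive (fun D => Pr (F `&` D)).
Proof.
rewrite (_ : (fun D => _) = mrestr Pr mF); first exact: (measure_additive (mrestr Pr mF)).
by apply/funext => D; rewrite /mrestr setIC.
Qed.

Lemma elementary_version_sub k : sub_measurable G (elementary_version F k).
Proof.
move=> B mB; exists (horizon k [set s | B (ratio s)]); first exact: path_measurable_horizon.
by rewrite setTI.
Qed.

Lemma elementary_version_bounded k : bounded_fun (elementary_version F k).
Proof.
split; first exact: sub_measurable_fun (elementary_version_sub k).
move=> w; have /andP[-> le1] := ratio01 (mkseq (trajectory V w) k).
by rewrite (le_trans le1)// ler1n.
Qed.

Lemma integral_elementary_version k D : measurable D ->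
  \int[Pr]_(w in D) (elementary_version F k w)%:E =
  \esum_(s in [set s | size s = k]) ((ratio s)%:E * Pr (D `&` prefix_event V s)).
Proof.
move=> mD; have [mv v2] := elementary_version_bounded k.
have av := integral_additive Pr mv (fun w => proj1 (andP (v2 w))).
rewrite -[D in LHS]setTI (_ : setT = trajectory V @^-1` horizon k setT)//.
rewrite (additive_horizon _ _ av pV mD).
rewrite (_ : [set s | size s = k /\ _] = [set s | size s = k]); last first.
  by apply/seteqP; split=> [s []|s].
apply: eq_esum => s /= sk; rewrite setIC -integral_cst; last exact: measurableI.
apply: eq_integral => w; rewrite inE => -[_ ws]; congr EFin.
by rewrite /elementary_version -sk ws.
Qed.

(** For an event of finite horizon there is equality from some rank on. The other
    events of V follow by the pi-lambda theorem; the passage to disjoint unions is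
    dominated, because the versions are at most 1. *)
Lemma elementary_version_cvg D : G D ->
  \int[Pr]_(w in D) (elementary_version F k w)%:E @[k --> \oo] --> Pr (F `&` D).
Proof.
have intF k D' : measurable D' -> \int[Pr]_(w in D') (elementary_version F k w)%:E \is a fin_num.
  by move=> mD'; exact: bounded_integral_fin (elementary_version_bounded k).
have v0 k w : (0 <= elementary_version F k w)%R.
  by have [_ /(_ w)/andP[]] := elementary_version_bounded k.
have hor n Q : \int[Pr]_(w in trajectory V @^-1` horizon n Q) (elementary_version F k w)%:E @[k --> \oo]
    --> Pr (F `&` trajectory V @^-1` horizon n Q).
  apply: cvg_near_cst; exists n => // k /= nk.
  have mh : measurable (trajectory V @^-1` horizon n Q).
    exact: (process_measurable pV (path_measurable_horizon _ _)).
  rewrite integral_elementary_version// (horizon_widen Q nk) setIC.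
  rewrite additive_horizon//; last exact: measure_additive.
  rewrite esum_mkcond [RHS]esum_mkcond; apply: eq_esum => s _.
  case: ifPn; last first.
    by rewrite notin_setE/= => sk; rewrite ifF//; apply/negbTE; rewrite notin_setE => -[].
  rewrite inE/= => sk; case: ifPn.
    rewrite inE/= => -[_ Qs].
    have -> : trajectory V @^-1` horizon k [set s | Q (take n s)] `&` prefix_event V s
        = prefix_event V s.
      by apply/seteqP; split=> [w []//|w ws]; split => //; rewrite /horizon/= -sk ws.
    by rewrite ratio_mul [in RHS]setIC.
  rewrite notin_setE/= => nQ.
  have -> : trajectory V @^-1` horizon k [set s | Q (take n s)] `&` prefix_event V s = set0.
    by apply/seteqP; split=> // w [+ ws]; rewrite /horizon/= -sk ws => Qs; apply: nQ.
  by rewrite measure0 mule0.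
move=> [E mE <-]; rewrite setTI; move: E mE; apply: path_ind => [//|E mE cE|H mH cH tH].
- have mVE : measurable (trajectory V @^-1` E) by exact: process_measurable.
  have cT := hor 0%N setT; rewrite (_ : _ @^-1` _ = setT)// in cT.
  rewrite (additive_compl additiveF mVE); last by apply: fin; exact: measurableI.
  under eq_fun => k.
    rewrite (additive_compl (integral_additive Pr (proj1 (elementary_version_bounded k)) (v0 k)) mVE); last exact: intF.
    over.
  apply: cvgeB => //; apply: fin_num_adde_defr; apply: fin; exact: measurableI.
- have mVH n : measurable (trajectory V @^-1` H n) by exact: process_measurable.
  have tVH : trivIset setT (fun n => trajectory V @^-1` H n).
    by move=> n m _ _ [w [Hn Hm]]; apply: (tH n m) => //; exists (trajectory V w).
  rewrite preimage_bigcup.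
  rewrite (additive_esum additiveF)//.
  under eq_fun => k.
    rewrite (additive_esum (integral_additive Pr (proj1 (elementary_version_bounded k)) (v0 k)))//.
    over.
  apply: (@esum_dominated_cvg _ _ _ _ (fun n => Pr (trajectory V @^-1` H n))) => //.
  + move=> k n; rewrite integral_ge0 ?lee_fin//=; last by move=> w _; rewrite lee_fin.
    rewrite integral_elementary_version// [leRHS](_ : _ = \int[Pr]_(w in trajectory V @^-1` H n) (cst 1 w)); last first.
      by rewrite integral_cst// mul1e.
    rewrite -integral_elementary_version//; apply: ge0_le_integral => //.
    * by move=> w _; rewrite lee_fin.
    * by apply/measurable_EFinP/measurable_funTS; have [] := elementary_version_bounded k.
    * by move=> w _; rewrite lee_fin; have /andP[] := ratio01 (mkseq (trajectory V w) k).
  + rewrite -(additive_esum (measure_additive Pr))//.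
    by rewrite ltey_eq fin//; exact: countable_bigcupT_measurable.
Qed.

End Elementary.
End SigmaProcess.

Section Factorization.
Context {R : realType} {d} {Om : measurableType d} (Pr : probability Om R).
Context {C : countType} (V : nat -> Om -> C).
Hypothesis pV : is_process V.

Local Notation G := (sigma_process V).

Let sG := sigma_process_algebra V.
Let subG := sigma_process_sub pV.

(** Conditional independence in expectation only, which is symmetric in the two
    processes. It yields the conditional statement because an event of V can be
    absorbed into E when V is a function of X. *)
Definition cond_factor (S1 S2 : countType) (X : nat -> Om -> S1) (Y : nat -> Om -> S2)
    (E : set (nat -> S1)) (F : set (nat -> S2)) :=
  forall u v, bounded_version Pr G (trajectory X @^-1` E) u ->
    bounded_version Pr G (trajectory Y @^-1` F) v ->
    \int[Pr]_w (u w * v w)%:E = Pr (trajectory X @^-1` E `&` trajectory Y @^-1` F).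

Lemma cond_factor_sym (S1 S2 : countType) (X : nat -> Om -> S1) (Y : nat -> Om -> S2) E F :
  cond_factor X Y E F -> cond_factor Y X F E.
Proof.
by move=> h u v bu bv; rewrite setIC -(h v u bv bu); apply: eq_integral => w _; rewrite mulrC.
Qed.

Section OneSide.
Context {S1 S2 : countType} {X : nat -> Om -> S1} {Y : nat -> Om -> S2}.
Hypotheses (pX : is_process X) (pY : is_process Y).

Let mX E : path_measurable E -> measurable (trajectory X @^-1` E).
Proof. exact: process_measurable. Qed.

Let mY F : path_measurable F -> measurable (trajectory Y @^-1` F).
Proof. exact: process_measurable. Qed.

(** For a fixed version v the factorization is an equality of two countably additive
    functions of E. *)
Lemma cond_factorE E F v : path_measurable E ->
  bounded_version Pr G (trajectory Y @^-1` F) v ->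
  cond_factor X Y E F <->
  \int[Pr]_(w in trajectory X @^-1` E) (v w)%:E
    = Pr (trajectory X @^-1` E `&` trajectory Y @^-1` F).
Proof.
move=> mE bv; have [sv v2 iv] := bv; split.
  have [u bu] := bounded_version_exists Pr sG subG (mX mE).
  by move=> /(_ u v bu bv) <-; rewrite (version_pull subG (mX mE) bu).
move=> e u v' bu bv'; rewrite -e -(version_pull subG (mX mE) bu)//.
have [su u2 _] := bu; have [_ _ iv'] := bv'.
under eq_integral do rewrite mulrC; under [RHS]eq_integral do rewrite mulrC.
apply: (equal_test subG) => //.
- exact: bounded_version_fun bv'.
- exact: bounded_version_fun bv.
- by move=> D GD; rewrite iv' ?iv.
Qed.

Let additive_v F v : bounded_version Pr G (trajectory Y @^-1` F) v ->
  countably_additive (fun D => \int[Pr]_(w in D) (v w)%:E).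
Proof.
move=> bv; have [mv v2] := bounded_version_fun subG bv.
by apply: integral_additive => // w; have /andP[] := v2 w.
Qed.

Let additive_F F : path_measurable F ->
  countably_additive (fun D => Pr (D `&` trajectory Y @^-1` F)).
Proof. by move=> mF; exact: (measure_additive (mrestr Pr (mY mF))). Qed.

Lemma cond_factor_horizon n Q F : path_measurable F ->
  (forall x, size x = n -> cond_factor X Y (horizon n [set x]) F) ->
  cond_factor X Y (horizon n Q) F.
Proof.
move=> mF h; have [v bv] := bounded_version_exists Pr sG subG (mY mF).
apply/(cond_factorE _ bv); first exact: path_measurable_horizon.
rewrite -[X in \int[Pr]_(w in X) _]setIT (additive_horizon _ _ (additive_v bv))//.
rewrite -[X in Pr (X `&` _)]setIT (additive_horizon _ _ (additive_F mF))//.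
apply: eq_esum => x /= [xn _]; rewrite !setIT prefix_eventE; apply/(cond_factorE _ bv).
  exact: path_measurable_horizon.
by rewrite xn; exact: h.
Qed.

Lemma cond_factor_path E F : path_measurable E -> path_measurable F ->
  (forall n Q, cond_factor X Y (horizon n Q) F) -> cond_factor X Y E F.
Proof.
move=> mE mF h; have [v bv] := bounded_version_exists Pr sG subG (mY mF).
apply/(cond_factorE mE bv); move: E mE; apply: path_ind.
- by move=> n Q; apply/(cond_factorE _ bv) => //; exact: path_measurable_horizon.
- move=> E mE eE.
  have tot : \int[Pr]_w (v w)%:E = Pr (setT `&` trajectory Y @^-1` F).
    by have := h 0%N setT => /(cond_factorE (path_measurable_horizon _ _) bv).
  have finE : Pr (trajectory X @^-1` E `&` trajectory Y @^-1` F) \is a fin_num.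
    by rewrite fin_num_measure//; apply: measurableI; [exact: mX|exact: mY].
  have := additive_compl (additive_v bv) (mX mE); rewrite eE => /(_ finE) ->.
  by rewrite tot (additive_compl (additive_F mF) (mX mE) finE).
- move=> H mH eH tH; rewrite preimage_bigcup.
  have tX : trivIset setT (fun n => trajectory X @^-1` H n).
    by move=> n m _ _ [w [Hn Hm]]; apply: (tH n m) => //; exists (trajectory X w).
  have mXH n : measurable (trajectory X @^-1` H n) by exact: mX.
  have [_ _ cv] := additive_v bv; have [_ _ cF] := additive_F mF.
  by rewrite cv// [RHS]cF//; apply: eq_eseriesr => n _; exact: eH.
Qed.

End OneSide.

Section Main.
Context {S1 S2 : countType} {X : nat -> Om -> S1} {Y : nat -> Om -> S2} (f : S1 -> C).
Hypotheses (pX : is_process X) (pY : is_process Y).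
Hypothesis VfX : forall t w, V t w = f (X t w).

(** The sum below is the expectation of the product of the conditional
    probabilities of the two prefixes given k letters of V. *)
Hypothesis prefix_limit : forall x y, size x = size y ->
  \esum_(s in [set s | size s = k])
     ((fine (Pr (prefix_event Y y `&` prefix_event V s)) / fine (Pr (prefix_event V s)))%:E
       * Pr (prefix_event X x `&` prefix_event V s)) @[k --> \oo]
  --> Pr (prefix_event X x `&` prefix_event Y y).

(** In the expectation of the product of the conditional probabilities given k
    letters, the factor of x may be replaced by the version u given the whole of V;
    the other factor then converges weakly to v. *)
Let cond_factor_prefix x y : size x = size y ->
  cond_factor X Y (horizon (size x) [set x]) (horizon (size y) [set y]).
Proof.
move=> xy u v bu bv; rewrite -!prefix_eventE in bu bv *.
have mEx : measurable (prefix_event X x) by exact: prefix_event_measurable.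
have mFy : measurable (prefix_event Y y) by exact: prefix_event_measurable.
apply: (@cvg_unique _ (@ereal_hausdorff R) _ _ _ _ _ (prefix_limit xy)).
have [su u2 _] := bu; have [_ _ iv] := bv.
have cw D : G D -> \int[Pr]_(w in D) (elementary_version Pr V (prefix_event Y y) k w)%:E
    @[k --> \oo] --> \int[Pr]_(w in D) (v w)%:E.
  by move=> GD; rewrite iv//; exact: elementary_version_cvg.
have e1 k : \int[Pr]_w (elementary_version Pr V (prefix_event Y y) k w * u w)%:E
    = \esum_(s in [set s | size s = k])
     ((fine (Pr (prefix_event Y y `&` prefix_event V s)) / fine (Pr (prefix_event V s)))%:E
       * Pr (prefix_event X x `&` prefix_event V s)).
  rewrite -integral_elementary_version//.
  under eq_integral do rewrite mulrC.
  rewrite (version_pull subG mEx bu)//; first exact: elementary_version_sub.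
  by have [] := elementary_version_bounded Pr pV mFy k.
have e2 : \int[Pr]_w (v w * u w)%:E = \int[Pr]_w (u w * v w)%:E.
  by apply: eq_integral => w _; rewrite mulrC.
have := weak_test subG (fun k => elementary_version_bounded Pr pV mFy k)
  (bounded_version_fun subG bv) su u2 cw.
by rewrite e2 (funext e1).
Qed.

(** Cylinders of equal lengths, then events with a common horizon, then arbitrary
    events in one argument after the other. *)
Lemma cond_factor_all E F : path_measurable E -> path_measurable F -> cond_factor X Y E F.
Proof.
move=> mE mF.
have same_horizon n Q Q' : cond_factor X Y (horizon n Q) (horizon n Q').
  apply: cond_factor_horizon => //; first exact: path_measurable_horizon.
  move=> x xn; apply/cond_factor_sym/cond_factor_horizon => //; first exact: path_measurable_horizon.
  move=> y yn; apply/cond_factor_sym; rewrite -{1}xn -yn; apply: cond_factor_prefix.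
  by rewrite xn yn.
have horizons n Q m Q' : cond_factor X Y (horizon n Q) (horizon m Q').
  by rewrite (horizon_widen Q (leq_maxl n m)) (horizon_widen Q' (leq_maxr n m)).
apply: cond_factor_path => // n Q; apply/cond_factor_sym.
apply: cond_factor_path => //; first exact: path_measurable_horizon.
by move=> m Q'; apply/cond_factor_sym.
Qed.

Let version_bounded E u : bounded_version Pr G E u -> cond_prob_version Pr G E u.
Proof.
move=> bu; have [su u2 iu] := bu; split=> //.
have bf := bounded_version_fun subG bu; have [mu _] := bf.
apply/integrableP; split; first exact/measurable_EFinP.
under eq_integral => w _.
  rewrite gee0_abs; last by rewrite lee_fin; have /andP[] := u2 w.
  over.
by rewrite ltey_eq (bounded_integral_fin Pr measurableT bf).
Qed.

(** With D an event of V and E' the part of E where V is in D, the function u 1_D is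
    a version for E', and the factorization for E' and F is the required identity
    on D. *)
Lemma cond_independent_prefix : cond_independent Pr X Y V.
Proof.
move=> E F mE mF.
have mXE : measurable (trajectory X @^-1` E) by exact: process_measurable.
have mYF : measurable (trajectory Y @^-1` F) by exact: process_measurable.
have [u bu] := bounded_version_exists Pr sG subG mXE.
have [v bv] := bounded_version_exists Pr sG subG mYF.
exists u, v; split; [exact: version_bounded|exact: version_bounded|].
have [su u2 iu] := bu; have [sv v2 iv] := bv.
have [mu _] := bounded_version_fun subG bu; have [mv _] := bounded_version_fun subG bv.
have suv : sub_measurable G (fun w => u w * v w)%R.
  by apply/(sub_measurableP sG)/measurable_funM; apply/(sub_measurableP sG).
have uv0 w : (0 <= u w * v w)%R.
  by rewrite mulr_ge0//; [have /andP[] := u2 w|have /andP[] := v2 w].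
have key D : G D -> \int[Pr]_(w in D) (u w * v w)%:E
    = Pr (trajectory X @^-1` E `&` trajectory Y @^-1` F `&` D).
  move=> GD; have mD := subG GD; have [K mK DK] := GD.
  pose E' := E `&` [set x : nat -> S1 | K (f \o x)].
  have mE' : path_measurable E' by apply: path_measurableI => //; exact: path_measurable_map.
  have E'E : trajectory X @^-1` E' = trajectory X @^-1` E `&` D.
    rewrite -DK setTI /E' preimage_setI; congr (_ `&` _).
    apply/seteqP; split=> w /=; rewrite (_ : f \o trajectory X w = trajectory V w)//;
      by apply/funext => t; rewrite /trajectory/= VfX.
  have s1 : sub_measurable G (\1_D : Om -> R).
    apply/(sub_measurableP sG); apply: measurable_indic.
    by rewrite measurable_subE.
  have bu' : bounded_version Pr G (trajectory X @^-1` E') (fun w => u w * \1_D w)%R.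
    split.
    - by apply/(sub_measurableP sG)/measurable_funM; apply/(sub_measurableP sG).
    - move=> w; rewrite indicE; case: (_ \in _); rewrite ?mulr1 ?mulr0 ?lexx//=.
    - move=> D' GD'; have mD' := subG GD'.
      have GDD : G (D' `&` D).
        have [K' mK' <-] := GD'; rewrite -DK !setTI -preimage_setI.
        by apply: sigma_processP; exact: path_measurableI.
      rewrite E'E -setIA (setIC D D') -iu// [RHS]integral_mkcondr; apply: eq_integral => w _.
      by rewrite patchE indicE; case: ifPn => _ /=; rewrite ?mulr1 ?mulr0.
  have := cond_factor_all mE' mF bu' bv; rewrite E'E setIAC => <-.
  rewrite [LHS]integral_mkcond; apply: eq_integral => w _.
  by rewrite patchE indicE; case: ifPn => _ /=; rewrite ?mulr1 ?mulr0 ?mul0r.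
split=> //.
apply/integrableP; split; first by apply/measurable_EFinP; exact: measurable_funM.
under eq_integral do rewrite gee0_abs ?lee_fin//.
rewrite key; last by exists setT; [exact: (path_measurable_horizon 0%N setT)|rewrite setTI].
by rewrite ltey_eq fin_num_measure//; apply: measurableI => //; exact: measurableI.
Qed.

End Main.
End Factorization.

(** * Realization of a Markov chain on the unit interval *)

Section UnitInterval.
Context {R : realType}.

Definition unit_lebesgue := mrestr (@lebesgue_measure R) (measurable_itv `[0%R, 1%R[).

HB.instance Definition _ := Measure.on unit_lebesgue.

Lemma unit_lebesgue_setT : unit_lebesgue [set: R] = 1.
Proof.
by rewrite /unit_lebesgue /mrestr setTI lebesgue_measure_itv/= lte_fin ltr01 sube0.
Qed.

HB.instance Definition _ :=
  @Measure_isProbability.Build _ _ R unit_lebesgue unit_lebesgue_setT.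

End UnitInterval.

Section Draw.
Context {R : realType} {S : countType} (p : S -> R).
Hypothesis hp : prob_vector p.

(** The mass of the state with code n, and 0 if n is not a code, so that the unit
    interval is cut into consecutive intervals indexed by nat. *)
Definition code_weight n : R := oapp p 0%R (@pickle_inv S n).

Definition cumulative n : R := (\sum_(i < n) code_weight i)%R.

Let w0 n : (0 <= code_weight n)%R.
Proof. by rewrite /code_weight; case: pickle_inv => //= s; have [] := hp. Qed.

Lemma cumulativeS n : cumulative n.+1 = (cumulative n + code_weight n)%R.
Proof. by rewrite /cumulative big_ord_recr. Qed.

Lemma cumulative_le m n : (m <= n)%N -> (cumulative m <= cumulative n)%R.
Proof.
move=> /subnKC <-; elim: (n - m)%N => [|k IH]; first by rewrite addn0.
by apply: (le_trans IH); rewrite addnS cumulativeS lerDl.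
Qed.

Lemma cumulative_ge0 n : (0 <= cumulative n)%R.
Proof. by rewrite /cumulative sumr_ge0. Qed.

Lemma cumulative_cvg : cumulative n @[n --> \oo] --> (1 : R)%R.
Proof.
have [p0 p1] := hp.
suff : (EFin \o cumulative) n @[n --> \oo] --> 1%:E by move=> /fine_cvg.
move: p1; rewrite esum_nneseries; last by move=> s; rewrite lee_fin.
move=> p1; rewrite -[X in _ --> X]p1.
have -> : EFin \o cumulative = fun n => \sum_(0 <= i < n) oapp (fun x => (p x)%:E) 0 (@pickle_inv S i).
  apply/funext => n; rewrite /= /cumulative -sumEFin big_mkord; apply: eq_bigr => i _.
  by rewrite /code_weight; case: pickle_inv.
by apply: is_cvg_nneseries => i _ _; case: pickle_inv => //= s; rewrite lee_fin.
Qed.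

Lemma cumulative_le1 n : (cumulative n <= 1)%R.
Proof.
have := cumulative_cvg => c; rewrite -(cvg_lim (@Rhausdorff R) c).
apply: nondecreasing_cvgn_le; last by apply/cvg_ex; exists 1%R.
by move=> i j; exact: cumulative_le.
Qed.

Lemma draw_exists (u : R) : (0 <= u < 1)%R -> exists n, (cumulative n <= u < cumulative n.+1)%R.
Proof.
move=> /andP[u0 u1].
have ex : exists n, (u < cumulative n)%R.
  apply: contrapT => /forallNP nex; have : (1 <= u)%R; last by rewrite leNgt u1.
  rewrite -(cvg_lim (@Rhausdorff R) cumulative_cvg); apply: limr_le.
    by apply/cvg_ex; exists 1%R; exact: cumulative_cvg.
  by apply: nearW => n; rewrite leNgt; apply/negP; exact: nex.
case: (ex_minnP ex) => -[|n] un min.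
  by move: un; rewrite /cumulative big_ord0 ltNge u0.
exists n; rewrite un andbT leNgt; apply/negP => /min.
by rewrite ltnn.
Qed.

Lemma draw_unique (u : R) m n : (cumulative m <= u < cumulative m.+1)%R ->
  (cumulative n <= u < cumulative n.+1)%R -> m = n.
Proof.
move=> /andP[m1 m2] /andP[n1 n2]; apply/eqP; rewrite eqn_leq; apply/andP; split.
  rewrite leqNgt; apply/negP => /cumulative_le nm.
  by have := lt_le_trans n2 (le_trans nm m1); rewrite ltxx.
rewrite leqNgt; apply/negP => /cumulative_le mn.
by have := lt_le_trans m2 (le_trans mn n1); rewrite ltxx.
Qed.

End Draw.

Section Realization.
Context {R : realType} {S : countType} (k : option S -> S -> R) (s0 : S).
Hypothesis hk : stochastic_kernel k.

(** The code of the state whose interval contains u. *)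
Definition draw (o : option S) (u : R) : nat :=
  xget 0%N [set n | (cumulative (k o) n <= u < cumulative (k o) n.+1)%R].

(** Current state and the rescaled position of the point inside the interval of
    the path followed so far; conditionally on that path the position is uniform. *)
Fixpoint interval_chain t (w : R) : option S * R :=
  if t is t'.+1 then
    let: (o, u) := interval_chain t' w in
    let n := draw o u in
    (@pickle_inv S n, (u - cumulative (k o) n) / code_weight (k o) n)%R
  else (None, w).

(** The value outside the unit interval only serves to make the coordinates
    measurable. *)
Definition realization t (w : R) : S :=
  if (0 <= w < 1)%R then odflt s0 (interval_chain t.+1 w).1 else s0.

Lemma drawP o (u : R) : (0 <= u < 1)%R ->
  (cumulative (k o) (draw o u) <= u < cumulative (k o) (draw o u).+1)%R.
Proof.
move=> u01; rewrite /draw; case: xgetP => [n -> //|no].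
by have [n hn] := draw_exists (hk o) u01; have := no n; case.
Qed.

Lemma draw_state o (u : R) : (0 <= u < 1)%R ->
  exists2 x, pickle_inv (draw o u) = Some x & (0 < k o x)%R.
Proof.
move=> u01; have /andP[le lt] := drawP o u01.
have := le_lt_trans le lt; rewrite cumulativeS// ltrDl /code_weight.
by case: pickle_inv => [x|] /=; [exists x|rewrite ltxx].
Qed.

Definition step_left o (x : S) : R := cumulative (k o) (pickle x).

Lemma step_left_le o x : (step_left o x + k o x <= 1)%R.
Proof.
have := cumulative_le1 (hk o) (pickle x).+1; rewrite cumulativeS /code_weight pickleK_inv.
exact.
Qed.

(** The points of the unit interval whose trajectory begins with s form an interval
    of length the weight of s, and on it the position is rescaled affinely to the
    unit interval. *)
Lemma realization_prefix s : exists2 l : R,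
  (0 <= l)%R /\ (l + path_weight k None s <= 1)%R &
  forall w, (0 <= w < 1)%R ->
    (prefix_event realization s w <-> (l <= w < l + path_weight k None s)%R) /\
    (prefix_event realization s w -> interval_chain (size s) w =
       (end_state None s, (w - l) / path_weight k None s)%R).
Proof.
elim/last_ind: s => [|s x [l [l0 l1] IH]].
  exists 0%R; first by rewrite add0r !lexx.
  by move=> w w01; rewrite /= add0r w01 subr0 divr1.
set o := end_state None s; set p := path_weight k None s in l1 IH *.
have p0 : (0 <= p)%R by exact: path_weight_ge0.
have kx0 : (0 <= k o x)%R by have [] := hk o.
have c0 : (0 <= step_left o x)%R by exact: (cumulative_ge0 (hk o)).
exists (l + p * step_left o x)%R.
  split; first by rewrite addr_ge0// mulr_ge0.
  rewrite path_weight_rcons -/p -/o -addrA -mulrDr (le_trans _ l1)// lerD2l.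
  by rewrite -[leRHS]mulr1 ler_wpM2l// step_left_le.
move=> w w01; have [iff1 chain] := IH _ w01.
rewrite path_weight_rcons -/p -/o prefix_event_rcons end_state_rcons size_rcons.
have in01 : prefix_event realization s w -> [/\ (0 < p)%R, (0 <= (w - l) / p)%R & ((w - l) / p < 1)%R].
  move=> /iff1 /andP[lw wl]; have pp : (0 < p)%R.
    by have := le_lt_trans lw wl; rewrite ltrDl.
  split => //; first by rewrite divr_ge0// subr_ge0.
  by rewrite ltr_pdivrMr// mul1r ltrBlDl.
have key : prefix_event realization s w -> realization (size s) w = x <->
    (step_left o x <= (w - l) / p < step_left o x + k o x)%R.
  move=> ws; have [pp u0 u1] := in01 ws.
  have u01 : (0 <= (w - l) / p < 1)%R by rewrite u0.
  rewrite /realization w01 /= (chain ws) -/o /=.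
  have hd := drawP o u01; have [y yE ky] := draw_state o u01.
  rewrite yE /=; split.
    move=> yx; rewrite -yx; move: hd; rewrite cumulativeS// /step_left.
    have -> : draw o ((w - l) / p) = pickle y by have := @pickle_invK S (draw o ((w - l) / p)); rewrite yE.
    by rewrite /code_weight pickleK_inv.
  move=> hx; suff dx : draw o ((w - l) / p) = pickle x.
    by move: yE; rewrite dx pickleK_inv => -[].
  apply: (draw_unique (hk o) hd); rewrite cumulativeS /code_weight pickleK_inv.
  exact: hx.
have eqv : prefix_event realization s w ->
   (step_left o x <= (w - l) / p < step_left o x + k o x)%R =
   (l + p * step_left o x <= w < l + p * step_left o x + p * k o x)%R.
  move=> ws; have [pp _ _] := in01 ws.
  rewrite ler_pdivlMr// ltr_pdivrMr// -addrA -mulrDr [(p * _)%R]mulrC [(p * _)%R]mulrC.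
  by rewrite lerBrDl ltrBlDl.
have iff2 : (prefix_event realization s `&` [set w | realization (size s) w = x]) w <->
   (l + p * step_left o x <= w < l + p * step_left o x + p * k o x)%R.
  split=> [[ws wx]|h]; first by rewrite -eqv//; exact/key.
  have ws : prefix_event realization s w.
    apply/iff1; move: h => /andP[h1 h2]; apply/andP; split.
      by apply: le_trans h1; rewrite lerDl mulr_ge0.
    apply: (lt_le_trans h2); rewrite -addrA -mulrDr lerD2l -[leRHS]mulr1 ler_wpM2l//.
    exact: step_left_le.
  by split => //; apply/(key ws); rewrite eqv.
split=> // -[ws wx].
have [pp u0 u1] := in01 ws; have u01 : (0 <= (w - l) / p < 1)%R by rewrite u0.
have [y yE ky] := draw_state o u01.
have dy : draw o ((w - l) / p) = pickle y.
  by have := @pickle_invK S (draw o ((w - l) / p)); rewrite yE.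
rewrite /= (chain ws) -/o -/p.
move: wx; rewrite /= /realization w01 /= (chain ws) -/o -/p yE /= => yx.
rewrite dy yx /code_weight pickleK_inv /=; congr (_, _).
rewrite -/(step_left o x); field.
by apply/andP; split; rewrite gt_eqF// -yx.
Qed.

Let interval_sub01 (l r : R) w : (0 <= l)%R -> (r <= 1)%R -> (l <= w < r)%R -> (0 <= w < 1)%R.
Proof. by move=> l0 r1 /andP[lw wr]; rewrite (le_trans l0 lw) (lt_le_trans wr r1). Qed.

Let realization_prefix_measurable s :
  measurable (prefix_event (Om := measurableTypeR R) realization s).
Proof.
have [l [l0 l1] h] := realization_prefix s.
rewrite [X in measurable X](_ : _ = `[l, (l + path_weight k None s)%R[%classic `|`
    (if nseq (size s) s0 == s then ~` `[0%R, 1%R[%classic else set0)); last first.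
  apply/seteqP; split=> w.
    have [w01|w01] := boolP (0 <= w < 1)%R.
      by move=> /(h _ w01).1 lw; left; rewrite /= in_itv.
    rewrite /prefix_event/= => ws; right.
    rewrite ifT; first by rewrite /= in_itv/=; exact/negP.
    rewrite -[X in _ == X]ws; apply/eqP; apply: (@eq_from_nth _ s0).
      by rewrite size_nseq size_mkseq.
    move=> i; rewrite size_nseq => is_; rewrite nth_nseq is_ nth_mkseq//.
    by rewrite /trajectory /realization (negbTE w01).
  move=> [/=|].
    rewrite in_itv/= => lw; apply/(h _ (interval_sub01 l0 l1 lw)).1.
    exact: lw.
  case: eqP => // ns /=; rewrite in_itv/= => /negP w01; rewrite /prefix_event/= -[RHS]ns.
  apply: (@eq_from_nth _ s0); first by rewrite size_nseq size_mkseq.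
  move=> i; rewrite size_mkseq => is_; rewrite nth_nseq is_ nth_mkseq//.
  by rewrite /trajectory /realization (negbTE w01).
apply: measurableU; first exact: measurable_itv.
by case: ifP => // _; apply: measurableC; exact: measurable_itv.
Qed.

Lemma realization_path_law : has_path_law (@unit_lebesgue R) k realization.
Proof.
split.
  move=> t U.
  rewrite [X in measurable X](_ : _ =
      \bigcup_s (if s \in [set s : seq S | size s = t.+1 /\ U (nth s0 s t)]
        then prefix_event realization s else set0)); last first.
    apply/seteqP; split=> w.
      move=> Uw; exists (mkseq (trajectory realization w) t.+1) => //.
      rewrite ifT; last by rewrite inE; split; rewrite ?size_mkseq ?nth_mkseq.
      by rewrite /prefix_event/mkset size_mkseq.
    move=> [s _]; case: ifPn => // /[1!inE] -[st Us]; rewrite /prefix_event/= st => ws.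
    by move: Us; rewrite -ws nth_mkseq.
  apply: countable_bigcupT_measurable; first exact: countableP.
  by move=> s; case: ifP => // _; exact: realization_prefix_measurable.
move=> s; have [l [l0 l1] h] := realization_prefix s.
transitivity (@lebesgue_measure R `[l, (l + path_weight k None s)%R[%classic).
  rewrite -[LHS]/(lebesgue_measure (prefix_event realization s `&` `[0%R, 1%R[%classic)).
  congr lebesgue_measure; apply/seteqP; split=> w /=.
    by rewrite in_itv/= => -[ws w01]; rewrite in_itv/=; exact/(h _ w01).1.
  by rewrite in_itv/= => lw; have w01 := interval_sub01 l0 l1 lw;
    split; [apply/(h _ w01).1|rewrite in_itv].
rewrite lebesgue_measure_itv/= lte_fin ltrDl.
case: ltP => [p0|p0]; first by rewrite -EFinB addrAC subrr add0r.
by congr EFin; apply/eqP; rewrite eq_le p0 path_weight_ge0.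
Qed.

End Realization.

Lemma path_law_MC (R : realType) d (Om : measurableType d) (Pr : probability Om R)
    (S : countType) (alpha : S -> R) (P : S -> S -> R) (X : nat -> Om -> S) :
  prob_vector alpha -> stochastic P ->
  has_path_law Pr (start_kernel alpha P) X -> is_MC Pr alpha P X.
Proof.
move=> pa sP [pX lX]; split => // [s|t x past].
  have := lX [:: s]; rewrite /= mulr1 => <-; congr (Pr _).
  by apply/seteqP; split=> w; rewrite /prefix_event/= /mkseq/= /trajectory; [move=> ->|move=> []].
have pastE : past = prefix_event X (mkseq x t.+1).
  apply/seteqP; split=> w; rewrite /prefix_event /mkset size_mkseq => h.
    by apply/eq_in_map => i; rewrite mem_iota add0n ltnS => /h.
  move=> i it; have := congr1 (nth (x 0%N) ^~ i) h.
  by rewrite !nth_mkseq.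
have sk : stochastic_kernel (start_kernel alpha P) by case.
rewrite /cond_prob setIC pastE => p0.
have -> : prefix_event X (mkseq x t.+1) `&` [set w | X t.+1 w = x t.+1]
    = prefix_event X (rcons (mkseq x t.+1) (x t.+1)).
  by rewrite prefix_event_rcons size_mkseq.
move: p0; rewrite !lX path_weight_rcons lte_fin [mkseq x t.+1]mkseqS end_state_rcons /= => p0.
by rewrite mulrAC divff ?mul1r// gt_eqF.
Qed.

(** * Chains with a common image in law *)

Section ImageLaw.
Context {R : realType} {A C : countType} (f : A -> C).
Context (kX : option A -> A -> R) (kZ : option C -> C -> R).
Context dX (OmX : measurableType dX) (PrX : probability OmX R) (Xbar : nat -> OmX -> A).
Context dZ (OmZ : measurableType dZ) (PrZ : probability OmZ R) (Zbar : nat -> OmZ -> C).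
Hypotheses (sX : stochastic_kernel kX) (sZ : stochastic_kernel kZ).
Hypotheses (hX : has_path_law PrX kX Xbar) (hZ : has_path_law PrZ kZ Zbar).
Hypothesis hfX : eq_law PrX (fun t w => f (Xbar t w)) PrZ Zbar.

Lemma image_prefix_law s :
  PrX (prefix_event (fun t w => f (Xbar t w)) s) = (path_weight kZ None s)%:E.
Proof.
have [_ <-] := hZ; rewrite !prefix_eventE; apply: hfX; exact: path_measurable_horizon.
Qed.

Lemma image_density_start s : image_density f kX None s = path_weight kZ None s.
Proof.
apply: EFin_inj; rewrite image_densityE// -image_prefix_law.
have := image_path_law f [::] s sX hX; rewrite mul1e => <-; congr (PrX _).
by apply/seteqP; split=> w; [case|split].
Qed.

(** A state visited with positive probability ends a path x of positive weight,
    and x followed by a path over s is one of the ways of following f x ++ s. *)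
Lemma visited_dominated :
  (forall a, 0 < PrX [set w | exists t, Xbar t w = a]) -> dominated_image kZ f kX.
Proof.
move=> vis [a|]; last first.
  (* From the starting state the image law is that of Z itself. *)
  by exists 1%R => // s; rewrite mul1r image_density_start.
have [pX lX] := hX.
have p0 x : (0 <= path_weight kX None x)%R by exact: path_weight_ge0.
have [x px] : exists x, (0 < path_weight kX None (rcons x a))%R.
  apply: contrapT => /forallNP no; have := vis a; rewrite ltNge => /negP; apply.
  rewrite (_ : [set w | _] = \bigcup_t [set w | Xbar t w = a]); last first.
    by apply/seteqP; split=> w [t]; exists t.
  have mt t : measurable [set w | Xbar t w = a] by exact: (pX t [set a]).
  have null t : PrX.-negligible [set w | Xbar t w = a].
    apply/negligibleP => //.
    rewrite (_ : [set w | _] = trajectory Xbar @^-1` horizon t.+1 [set s | exists x, s = rcons x a]); last first.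
      apply/seteqP; split=> w; rewrite /horizon/= mkseqS.
        by move=> <-; exists (mkseq (trajectory Xbar w) t).
      by move=> [x /rcons_inj[_]].
    have := additive_horizon t.+1 [set s | exists x, s = rcons x a]
      (measure_additive PrX) pX measurableT.
    rewrite setIT => e; rewrite [LHS]e; apply: esum1 => s [_ [x ->]]; rewrite setIT [LHS]lX; congr EFin.
    by apply/eqP; rewrite eq_le p0 andbT leNgt; apply/negP; exact: no.
  have /negligibleP -> // : PrX.-negligible (\bigcup_t [set w | Xbar t w = a]).
    exact: negligible_bigcup.
  exact: bigcup_measurable.
exists (path_weight kX None (rcons x a))^-1%R; first by rewrite invr_ge0.
move=> s; rewrite ler_pdivlMl//.
have mX y : measurable (prefix_event Xbar y) by exact: prefix_event_measurable.
have mfX y : measurable (prefix_event (fun t w => f (Xbar t w)) y).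
  by apply: prefix_event_measurable; exact: process_map.
have := image_path_law f (rcons x a) s sX hX.
rewrite end_state_rcons -image_densityE// -EFinM => e.
rewrite -lee_fin -e; apply: (@le_trans _ _ (path_weight kZ None (map f (rcons x a) ++ s))%:E).
  rewrite -image_prefix_law; apply: le_measure; rewrite ?inE; [exact: measurableI|exact: mfX|exact: subIsetr].
rewrite lee_fin path_weight_cat map_rcons end_state_rcons ler_piMl//; first exact: path_weight_ge0.
by rewrite -lee_fin -map_rcons -image_prefix_law probability_le1.
Qed.

End ImageLaw.

(** * The coupling *)

Section Coupling.
Context {R : realType} {A B C : countType} (f : A -> C) (g : B -> C).
Context (alphaX : A -> R) (PX : A -> A -> R) (alphaY : B -> R) (PY : B -> B -> R).
Context (alphaZ : C -> R) (PZ : C -> C -> R).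
Let kX := start_kernel alphaX PX.
Let kY := start_kernel alphaY PY.
Let kZ := start_kernel alphaZ PZ.
Hypotheses (sX : stochastic_kernel kX) (sY : stochastic_kernel kY) (sZ : stochastic_kernel kZ).
Hypotheses (dX : dominated_image kZ f kX) (dY : dominated_image kZ g kY).
Hypothesis lX : forall s, image_density f kX None s = path_weight kZ None s.
Hypothesis lY : forall s, image_density g kY None s = path_weight kZ None s.

Let kX0 o a : (0 <= kX o a)%R. Proof. by have [] := sX o. Qed.
Let kY0 o a : (0 <= kY o a)%R. Proof. by have [] := sY o. Qed.
Let kZ0 o a : (0 <= kZ o a)%R. Proof. by have [] := sZ o. Qed.

Let phi : Delta f g -> R := harmonic alphaX PX alphaY PY alphaZ PZ (f := f) (g := g).
Let M (x y : Delta f g) : \bar R := (Rmx PX PY PZ x y)%:E.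
Let alphaW := alphaD' alphaX alphaY alphaZ (phi := phi).
Let PW := PD' PX PY PZ (phi := phi).

Let compat (x : Delta f g) : omap f (Some (val x).1) = omap g (Some (val x).2).
Proof. by rewrite /= (eqP (valP x)). Qed.

Let RmxE' (x y : Delta f g) : Rmx PX PY PZ x y = step_ratio (kX := kX) (kY := kY) (kZ := kZ) (f := f)
  (Some (val x).1) (Some (val x).2) (val y).1 (val y).2.
Proof. exact: (RmxE PX PY sZ). Qed.

Lemma Rmx_ge0 (x y : Delta f g) : (0 <= Rmx PX PY PZ x y)%R.
Proof. by rewrite RmxE' !mulr_ge0// invr_ge0. Qed.

Lemma harmonic_ge0 x : (0 <= phi x)%R.
Proof. exact: overlap_lim_ge0. Qed.

Lemma mx_pow_ge0 m x y : 0 <= mx_pow M m x y.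
Proof.
elim: m x y => [|m IH] x y; first by rewrite /mx_pow/= /mx_one; case: ifP.
by apply: esum_ge0 => z _; rewrite mule_ge0 ?lee_fin ?Rmx_ge0//; exact: IH.
Qed.

(** Both sides satisfy the same recursion. *)
Lemma mx_pow_app_one m x :
  mx_app (mx_pow M m) (fun=> 1) x = overlap f g kX kY kZ m (Some (val x).1) (Some (val x).2).
Proof.
elim: m x => [|m IH] x.
  rewrite /mx_app /overlap /pairing esum_size0; last first.
    by rewrite lee_fin /image_density/= invr1 !mulr1.
  rewrite /image_density/= invr1 !mulr1 /mx_one.
  under eq_esum do rewrite mule1.
  rewrite (esumID [set x]) => [|y _]; last by case: ifP.
  rewrite setTI esum_set1 ?eqxx//= esum1 ?adde0// => y [_ /= /eqP].
  by rewrite eq_sym => /negbTE ->.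
rewrite (overlapS sX sY sZ m (compat x)).
rewrite esum_graph; last first.
  by move=> a b; rewrite mule_ge0 ?overlap_ge0// lee_fin !mulr_ge0// invr_ge0.
transitivity (\esum_(y in [set: Delta f g]) \esum_(z in [set: Delta f g]) (M x y * mx_pow M m y z)).
  rewrite esum_swap; last by move=> y z _ _; rewrite mule_ge0 ?lee_fin ?Rmx_ge0// mx_pow_ge0.
  by apply: eq_esum => z _; rewrite mule1.
apply: eq_esum => y _; rewrite esumZl ?Rmx_ge0//; last by move=> z _; exact: mx_pow_ge0.
rewrite -IH /M RmxE'; congr (_ * _); apply: eq_esum => z _; by rewrite mule1.
Qed.

Lemma mx_app_harmonic x : mx_app M (EFin \o phi) x = (phi x)%:E.
Proof.
rewrite -[RHS](overlap_lim_step sX sY sZ dX dY (compat x)).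
rewrite esum_graph; last first.
  by move=> a b; rewrite mule_ge0 ?lee_fin ?overlap_lim_ge0// !mulr_ge0// invr_ge0.
by apply: eq_esum => y _; rewrite /M RmxE'.
Qed.

(** Terms off the support vanish, so sums over Delta' are sums over Delta. *)
Let esum_support (F : Delta f g -> R) : (forall x, 0 <= F x)%R ->
  \esum_(x in [set: Delta' phi]) (F (val x) * phi (val x))%:E
  = \esum_(x in [set: Delta f g]) (F x * phi x)%:E.
Proof.
move=> F0; rewrite (esum_sig (fun x => 0 < phi x)%R (fun x => (F x * phi x)%:E)).
rewrite [LHS]esum_mkcond; apply: eq_esum => x _; case: ifPn => //.
rewrite notin_setE/= => /negP; rewrite -leNgt => p0.
have -> : phi x = 0%R by apply/eqP; rewrite eq_le p0 harmonic_ge0.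
by rewrite mulr0.
Qed.

(** The harmonicity of phi at the pair of starting states, where phi is 1. *)
Lemma alphaD'_prob : prob_vector alphaW.
Proof.
have aE x : alphaW x = (alphaX (fstD' x) * alphaY (sndD' x) / alphaZ (f (fstD' x)) * phi (val x))%R.
  exact: (alphaD'E sZ).
have a0 (x : Delta f g) : (0 <= alphaX (val x).1 * alphaY (val x).2 / alphaZ (f (val x).1))%R.
  by rewrite !mulr_ge0 ?invr_ge0 ?(kX0 None) ?(kY0 None) ?(kZ0 None).
split=> [x|]; first by rewrite aE mulr_ge0 ?harmonic_ge0// a0.
under eq_esum do rewrite aE.
rewrite (esum_support a0) -[RHS]/(1%:E) -(overlap_lim_start sY lX lY).
rewrite -(@overlap_lim_step _ _ _ _ _ _ _ _ _ sX sY sZ dX dY None None erefl).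
rewrite esum_graph => [|a b].
  by apply: eq_esum => x _.
by rewrite mule_ge0 ?lee_fin ?overlap_lim_ge0// !mulr_ge0// invr_ge0.
Qed.

Lemma PD'_stochastic : stochastic PW.
Proof.
move=> x; have px : (0 < phi (val x))%R by exact: (valP x).
split=> [y|]; first by rewrite !mulr_ge0 ?invr_ge0 ?Rmx_ge0 ?harmonic_ge0.
have c0 y : (0 <= (phi (val x))^-1 * Rmx PX PY PZ (val x) y)%R.
  by rewrite mulr_ge0 ?Rmx_ge0// invr_ge0 ltW.
rewrite (esum_support c0).
under eq_esum do rewrite -mulrA EFinM EFinM.
rewrite esumZl; last 2 first.
- by rewrite invr_ge0 ltW.
- by move=> y _; rewrite mule_ge0 ?lee_fin ?Rmx_ge0 ?harmonic_ge0.
by rewrite [X in _ * X]mx_app_harmonic -EFinM mulVf// gt_eqF.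
Qed.

Lemma support_inhabited : exists x : Delta' phi, True.
Proof.
apply: contrapT => /forallNP no; have [_] := alphaD'_prob.
rewrite esum1 => [/esym/eqP|x _]; last by have := no x.
by rewrite onee_eq0.
Qed.

Section Chain.
Context d (Om : measurableType d) (Pr : probability Om R) (W : nat -> Om -> Delta' phi).
Hypothesis hW : is_MC Pr alphaW PW W.

Let X t w := fstD' (W t w).
Let Y t w := sndD' (W t w).
Let V t w := f (X t w).

Let lW := MC_path_law hW.
Let hXl : has_path_law Pr kX X.
Proof. exact: (fst_path_law sX sY sZ dX dY lX lY lW). Qed.
Let hYl : has_path_law Pr kY Y.
Proof. exact: (snd_path_law sX sY sZ dX dY lX lY lW). Qed.

Let VgY : V = fun t w => g (Y t w).
Proof. by apply/funext => t; apply/funext => w; exact: fst_sndD'. Qed.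

Let V_law s : Pr (prefix_event V s) = (path_weight kZ None s)%:E.
Proof.
rewrite -lX image_densityE//; have := image_path_law f [::] s sX hXl; rewrite mul1e => <-.
by congr (Pr _); apply/seteqP; split=> w; [split|case].
Qed.

Let esum_prefixed (T : choiceType) (c : seq T) j (F : seq T -> \bar R) :
  (forall s, 0 <= F s) -> (forall s, size s = (size c + j)%N -> take (size c) s <> c -> F s = 0) ->
  \esum_(s in [set s | size s = (size c + j)%N]) F s
  = \esum_(s in [set s | size s = j]) F (c ++ s).
Proof.
move=> F0 Fc; rewrite (esumID [set s | take (size c) s = c])//.
rewrite [X in _ + X]esum1 ?adde0; last by move=> s [/= sj nc]; exact: Fc.
apply: (reindex_esum _ _ (cat c)); split=> /=.
- by move=> s /= <-; rewrite size_cat take_size_cat.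
- by move=> s s' _ _ /eqP; rewrite eqseq_cat// eqxx/= => /eqP.
- move=> s [/= sj tc]; exists (drop (size c) s); last by rewrite -{1}tc cat_take_drop.
  by rewrite /= size_drop sj addKn.
Qed.

(** For k beyond the common length of x and y only the words that extend f x count,
    and they contribute the overlap from the ends of x and y. *)
Let prefix_limit x y : size x = size y ->
  \esum_(s in [set s | size s = k])
     ((fine (Pr (prefix_event Y y `&` prefix_event V s)) / fine (Pr (prefix_event V s)))%:E
       * Pr (prefix_event X x `&` prefix_event V s)) @[k --> \oo]
  --> Pr (prefix_event X x `&` prefix_event Y y).
Proof.
move=> xy; set F := fun s : seq C => (_ / _)%:E * _.
have F0 s : 0 <= F s by rewrite mule_ge0// lee_fin divr_ge0// fine_ge0.
have XV s k : size s = (size (map f x) + k)%N -> prefix_event X x `&` prefix_event V s !=set0 ->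
    take (size (map f x)) s = map f x.
  move=> ss [w [wx ws]]; rewrite -ws -map_take take_iota ss (minn_idPl (leq_addr _ _)) size_map.
  by rewrite -[in RHS]wx /mkseq -map_comp.
have YV s : prefix_event Y y `&` prefix_event V (map f x ++ s) !=set0 -> map f x = map g y.
  move=> [w [wy]]; rewrite VgY /prefix_event/= size_cat size_map => /(congr1 (take (size x))).
  rewrite -map_take take_iota (minn_idPl (leq_addr _ _)) take_size_cat ?size_map// => <-.
  by rewrite -[in RHS]wy -xy /mkseq -map_comp.
rewrite [X in _ --> X](joint_path_law sX sY sZ dX dY lX lY lW xy).
have E0 k : \esum_(s in [set s | size s = (k + size (map f x))%N]) F s
    = \esum_(s in [set s | size s = k]) F (map f x ++ s).
  rewrite addnC esum_prefixed// => s ss nt.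
  rewrite /F (_ : prefix_event X x `&` _ = set0) ?measure0 ?mule0//.
  by apply: contrapT => /eqP/set0P ne; apply: nt; exact: XV ss ne.
suff : \esum_(s in [set s | size s = k]) F (map f x ++ s) @[k --> \oo] -->
    (if map f x == map g y then joint_weight (f := f) (g := g) (kX := kX) (kY := kY) (kZ := kZ) x y
     else 0%R)%:E.
  rewrite -(funext E0).
  by rewrite (cvg_shiftn (size (map f x)) (fun k => \esum_(s in [set s | size s = k]) F s)).
case: eqP => [e|ne]; last first.
  apply: cvg_near_cst; apply: nearW => k; apply: esum1 => s _.
  rewrite /F (_ : prefix_event Y y `&` _ = set0) ?measure0 ?mul0r ?mul0e//.
  by apply: contrapT => /eqP/set0P /YV.
have E k : \esum_(s in [set s | size s = k]) F (map f x ++ s) =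
    (path_weight kX None x * path_weight kY None y / path_weight kZ None (map f x))%:E
     * overlap f g kX kY kZ k (end_state None x) (end_state None y).
  rewrite -esumZl; first last.
  - move=> s _; rewrite lee_fin !mulr_ge0 ?invr_ge0 ?path_weight_ge0//.
      by rewrite -lee_fin image_densityE// image_weight_ge0.
    by rewrite -lee_fin image_densityE// image_weight_ge0.
  - by rewrite !mulr_ge0 ?invr_ge0 ?path_weight_ge0.
  apply: eq_esum => s _; rewrite /F V_law [Pr (prefix_event X x `&` _)](image_path_law f x s sX hXl).
  rewrite {1}e VgY (image_path_law g y s sY hYl) -!image_densityE// -!EFinM; congr EFin.
  rewrite /= path_weight_cat invfM -[end_state None (map f x)]/(end_state (omap f None) (map f x)).
  by rewrite end_state_map; ring.
rewrite (funext E) [X in _ --> X](EFinM _ (overlap_lim f g kX kY kZ _ _)); apply: cvgeZl => //.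
exact/(overlap_cvg sX sY sZ dX dY)/end_state_compat.
Qed.

Lemma coupling_law dX' (OmX : measurableType dX') (PrX : probability OmX R) (Xbar : nat -> OmX -> A)
    dY' (OmY : measurableType dY') (PrY : probability OmY R) (Ybar : nat -> OmY -> B) :
  has_path_law PrX kX Xbar -> has_path_law PrY kY Ybar ->
  [/\ eq_law Pr X PrX Xbar, eq_law Pr Y PrY Ybar, forall t w, f (X t w) = g (Y t w) &
     cond_independent Pr X Y V].
Proof.
move=> hX hY; have [pX lX'] := hXl; have [pY lY'] := hYl.
split.
- by apply: law_unique => // [|s]; [case: hX|rewrite lX'; case: hX].
- by apply: law_unique => // [|s]; [case: hY|rewrite lY'; case: hY].
- by move=> t w; exact: fst_sndD'.
- exact: (cond_independent_prefix (process_map f pX) pX pY (fun _ _ => erefl) prefix_limit).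
Qed.

End Chain.
End Coupling.

Theorem mainTheorem6 (R : realType) (A B C : countType)
    (f : A -> C) (g : B -> C)
    (alphaX : A -> R) (PX : A -> A -> R)
    (alphaY : B -> R) (PY : B -> B -> R)
    (alphaZ : C -> R) (PZ : C -> C -> R)
    (dX : measure_display) (OmegaX : measurableType dX)
    (PrX : probability OmegaX R) (Xbar : nat -> OmegaX -> A)
    (dY : measure_display) (OmegaY : measurableType dY)
    (PrY : probability OmegaY R) (Ybar : nat -> OmegaY -> B)
    (dZ : measure_display) (OmegaZ : measurableType dZ)
    (PrZ : probability OmegaZ R) (Zbar : nat -> OmegaZ -> C)
    (hX : is_MC PrX alphaX PX Xbar)
    (hY : is_MC PrY alphaY PY Ybar)
    (hZ : is_MC PrZ alphaZ PZ Zbar)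
    (hfX : eq_law PrX (fun t w => f (Xbar t w)) PrZ Zbar)
    (hgY : eq_law PrZ Zbar PrY (fun t w => g (Ybar t w)))
    (hvX : forall a, 0 < PrX [set w | exists t, Xbar t w = a])
    (hvY : forall b, 0 < PrY [set w | exists t, Ybar t w = b]) :
  let M := fun x y : Delta f g => (Rmx PX PY PZ x y)%:E in
  let RmOne := fun m x => mx_app (mx_pow M m) (fun=> 1) x in
  exists phi : Delta f g -> R,
  let alpha := alphaD' alphaX alphaY alphaZ (phi := phi) in
  let P := PD' PX PY PZ (phi := phi) in
  [/\ (* (i) *)
      [/\ forall m x, RmOne m x \is a fin_num,
          forall x, RmOne m x @[m --> \oo] --> (phi x)%:E,
          forall x, (0 <= phi x)%R &
          right_eigenvector M 1%R phi],
      (* (ii) *)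
      prob_vector alpha /\ stochastic P &
      (* (iii) *)
      (exists (d : measure_display) (Omega : measurableType d)
         (Pr : probability Omega R) (W : nat -> Omega -> Delta' phi),
         is_MC Pr alpha P W) /\
      (forall (d : measure_display) (Omega : measurableType d)
         (Pr : probability Omega R) (W : nat -> Omega -> Delta' phi),
       is_MC Pr alpha P W ->
       let X := fun t w => fstD' (W t w) in
       let Y := fun t w => sndD' (W t w) in
       [/\ eq_law Pr X PrX Xbar,
           eq_law Pr Y PrY Ybar,
           forall t w, f (X t w) = g (Y t w) &
           cond_independent Pr X Y (fun t w => f (X t w))])].
Proof.
move=> M RmOne.
pose kX := start_kernel alphaX PX; pose kY := start_kernel alphaY PY.
pose kZ := start_kernel alphaZ PZ.
have sX : stochastic_kernel kX by case: hX => pa sP _ _ _ [].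
have sY : stochastic_kernel kY by case: hY => pa sP _ _ _ [].
have sZ : stochastic_kernel kZ by case: hZ => pa sP _ _ _ [].
have lawX : has_path_law PrX kX Xbar by exact: MC_path_law.
have lawY : has_path_law PrY kY Ybar by exact: MC_path_law.
have lawZ : has_path_law PrZ kZ Zbar by exact: MC_path_law.
have hgY' : eq_law PrY (fun t w => g (Ybar t w)) PrZ Zbar by move=> E mE; rewrite hgY.
have dX' := visited_dominated sX sZ lawX lawZ hfX hvX.
have dY' := visited_dominated sY sZ lawY lawZ hgY' hvY.
have lX := image_density_start sX lawX lawZ hfX.
have lY := image_density_start sY lawY lawZ hgY'.
exists (harmonic alphaX PX alphaY PY alphaZ PZ); move=> alpha P.
have pa : prob_vector alpha := alphaD'_prob sX sY sZ dX' dY' lX lY.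
have sP : stochastic P := PD'_stochastic sX sY sZ dX' dY'.
have RmE m x : RmOne m x = overlap f g kX kY kZ m (Some (val x).1) (Some (val x).2).
  exact: mx_pow_app_one.
have [x0 _] := support_inhabited sX sY sZ dX' dY' lX lY.
have compat (x : Delta f g) : omap f (Some (val x).1) = omap g (Some (val x).2).
  by rewrite /= (eqP (valP x)).
split; [split|by []|split].
- by move=> m x; rewrite RmE; exact: (overlap_fin sX sY sZ dX' dY').
- by move=> x; under eq_fun do rewrite RmE; exact: (overlap_cvg sX sY sZ dX' dY').
- by move=> x; exact: harmonic_ge0.
- split; first by exists (val x0); rewrite gt_eqF// (valP x0).
  by move=> x; rewrite mul1r; exact: mx_app_harmonic.
- exists _, _, (@unit_lebesgue R), (realization (start_kernel alpha P) x0).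
  by apply: path_law_MC => //; apply: realization_path_law; case.
- by move=> d Omega Pr W hW; exact: coupling_law.
Qed.
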